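(* The problem of computing the prickliness of a 2.5D terrain is 3SUM-hard. Specifically, $\textsc{3sum} \lll_{n\log n} \textsc{prickliness}$: every instance of $\textsc{3sum}$ of size $n$ can be solved using a constant number of instances of $\textsc{prickliness}$ of at most linear size (in $n$) and $O(n\log n)$ additional time.
   Context: $\textsc{3sum}$ is the problem of deciding, given a set of $n$ integers, whether it contains three elements $a,b,c$ with $a+b+c=0$. For two problems $\textsc{pr1}$ and $\textsc{pr2}$, one writes $\textsc{pr1}\lll_{f(n)}\textsc{pr2}$ if and only if every instance of $\textsc{pr1}$ of size $n$ can be solved using a constant number of instances of $\textsc{pr2}$ of at most linear size and $O(f(n))$ additional time. $\textsc{prickliness}$ is the problem of computing $\pi(T)$ for a given 2.5D terrain $T$ (size = number of vertices), where $\pi(T)$ is defined as follows. A 2.5D terrain (TIN) $T$ is a triangulated $xy$-monotone polyhedral surface in $\mathbb{R}^3$; two vertices are neighbors if they are joined by an edge of the triangulation. A vertex is internal if it is not on the boundary of the triangulation (not incident to the unbounded face of the triangulation projected to the $xy$-plane). A vertex $v$ is convex if there is a non-vertical plane through $v$ that leaves all neighboring points of $v$ on $T$ below it. For a vector $\vec w\in\mathbb{R}^3$, a vertex $v$ is a local maximum of $T$ in direction $\vec w$ if $\langle v,\vec w\rangle > \langle u,\vec w\rangle$ for every neighbor $u$ of $v$. Let $\pi_{\vec w}(T)$ be the number of internal and convex vertices of $T$ that are local maxima of $T$ in direction $\vec w$. The prickliness of $T$ is $\pi(T)=\max_{\vec w}\pi_{\vec w}(T)$ (equivalently, the maximum over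 all invertible affine transformations $A$ of $\mathbb{R}^3$ of the number of internal and convex vertices of $T$ that are local maxima, in the vertical direction, of $A(T)$). Known result that may be used: $\textsc{3sum}\lll_{n\log n}\textsc{strips-cover-box}$ (Gajentaan and Overmars), where $\textsc{strips-cover-box}$ asks, given a square $Q$ in $\mathbb{R}^2$ and $n$ strips (a strip being the area between two parallel lines), whether every point of $Q$ is contained in at least one strip. *)

(* Defs.v *)
(* MathComp / MathComp-Analysis, over an arbitrary R : realType. *)
From HB Require Import structures.
From mathcomp Require Import all_boot all_order all_algebra.
From mathcomp Require Import all_classical all_reals all_analysis.

Set Implicit Arguments.
Unset Strict Implicit.
Unset Printing Implicit Defensive.

Import Order.TTheory GRing.Theory Num.Theory.
Import numFieldNormedType.Exports.

Local Open Scope classical_set_scope.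
Local Open Scope ring_scope.

(** * Computational problems

    An instance is presented to a machine as a sequence of words (natural
    numbers used for sizes and indices) and a sequence of real numbers.
    Only valid instances count.  Decision problems answer 0 or 1. *)

Record problem (R : Type) := Problem {
  instance : Type;
  valid : instance -> Prop;
  isize : instance -> nat;
  enc_words : instance -> seq nat;
  enc_reals : instance -> seq R;
  answer : instance -> nat }.

(** * The real RAM

    A program is a fixed finite command over word variables, real variables,
    and named arrays of words and of reals.  Words only have addition,
    truncated subtraction and comparison; reals have exact field operations
    and comparison, and there is no conversion (such as the floor function)
    from reals to words.  Each assignment, test and oracle query has unit
    cost: the expressions in a program have constant size. *)

Inductive iexpr :=
| IVar of nat
| ICst of nat
| IGet of nat & iexpr
| IAdd of iexpr & iexpr
| ISub of iexpr & iexpr.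

Inductive rexpr :=
| RVar of nat
| RCst of int
| RGet of nat & iexpr
| RAdd of rexpr & rexpr
| RSub of rexpr & rexpr
| RMul of rexpr & rexpr
| RDiv of rexpr & rexpr.

Inductive bexpr :=
| ILe of iexpr & iexpr
| RLe of rexpr & rexpr
| BNot of bexpr
| BAnd of bexpr & bexpr.

Inductive cmd :=
| Skip
| ISet of nat & iexpr
| IPut of nat & iexpr & iexpr
| RSet of nat & rexpr
| RPut of nat & iexpr & rexpr
| Seq of cmd & cmd
| If of bexpr & cmd & cmd
| While of bexpr & cmd
| Query of nat & nat & nat.

Section Machine.
Variable R : realType.

Record state := State {
  ivar : nat -> nat;
  rvar : nat -> R;
  iarr : nat -> nat -> nat;
  rarr : nat -> nat -> R }.

Fixpoint ieval (s : state) (e : iexpr) : nat :=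
  match e with
  | IVar x => ivar s x
  | ICst k => k
  | IGet a e1 => iarr s a (ieval s e1)
  | IAdd e1 e2 => (ieval s e1 + ieval s e2)%N
  | ISub e1 e2 => (ieval s e1 - ieval s e2)%N
  end.

(* Division by zero yields 0, as everywhere in MathComp. *)
Fixpoint reval (s : state) (e : rexpr) : R :=
  match e with
  | RVar x => rvar s x
  | RCst z => z%:~R
  | RGet a e1 => rarr s a (ieval s e1)
  | RAdd e1 e2 => reval s e1 + reval s e2
  | RSub e1 e2 => reval s e1 - reval s e2
  | RMul e1 e2 => reval s e1 * reval s e2
  | RDiv e1 e2 => reval s e1 / reval s e2
  end.

Fixpoint beval (s : state) (b : bexpr) : bool :=
  match b with
  | ILe e1 e2 => (ieval s e1 <= ieval s e2)%N
  | RLe e1 e2 => reval s e1 <= reval s e2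
  | BNot b1 => ~~ beval s b1
  | BAnd b1 b2 => beval s b1 && beval s b2
  end.

Definition upd (T : Type) (f : nat -> T) (x : nat) (v : T) : nat -> T :=
  fun y => if y == x then v else f y.

Definition set_ivar (s : state) (x v : nat) : state :=
  State (upd (ivar s) x v) (rvar s) (iarr s) (rarr s).

Definition set_rvar (s : state) (x : nat) (v : R) : state :=
  State (ivar s) (upd (rvar s) x v) (iarr s) (rarr s).

Definition set_iarr (s : state) (a i v : nat) : state :=
  State (ivar s) (rvar s) (upd (iarr s) a (upd (iarr s a) i v)) (rarr s).

Definition set_rarr (s : state) (a i : nat) (v : R) : state :=
  State (ivar s) (rvar s) (iarr s) (upd (rarr s) a (upd (rarr s a) i v)).

Definition stores (T : Type) (arr : nat -> T) (l : seq T) : Prop :=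
  forall x0 i, (i < size l)%N -> arr i = nth x0 l i.

(* The input is in the arrays named 0; all other cells are zero. *)
Definition init (P : problem R) (x : instance P) : state :=
  State (fun=> 0%N) (fun=> 0)
    (fun a i => if a == 0%N then nth 0%N (enc_words x) i else 0%N)
    (fun a i => if a == 0%N then nth 0 (enc_reals x) i else 0).

(* [exec W P c s s' t qs]: from s, the command c halts in s' after t steps,
   and qs lists the sizes of the instances of P submitted to the oracle.
   W bounds the words and addresses that can be stored; a run that exceeds it
   gets stuck.  A query [Query a b x] needs a valid instance of P in the
   initial segments of the word array a and of the real array b; otherwise it
   gets stuck. *)
Inductive exec (W : nat) (P : problem R) :
    cmd -> state -> state -> nat -> seq nat -> Prop :=
| ExSkip s :
    exec W P Skip s s 0 [::]
| ExISet s x e :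
    (ieval s e <= W)%N ->
    exec W P (ISet x e) s (set_ivar s x (ieval s e)) 1 [::]
| ExIPut s a e1 e2 :
    (ieval s e1 <= W)%N -> (ieval s e2 <= W)%N ->
    exec W P (IPut a e1 e2) s (set_iarr s a (ieval s e1) (ieval s e2)) 1 [::]
| ExRSet s x e :
    exec W P (RSet x e) s (set_rvar s x (reval s e)) 1 [::]
| ExRPut s a e1 e2 :
    (ieval s e1 <= W)%N ->
    exec W P (RPut a e1 e2) s (set_rarr s a (ieval s e1) (reval s e2)) 1 [::]
| ExSeq s1 s2 s3 c1 c2 t1 t2 q1 q2 :
    exec W P c1 s1 s2 t1 q1 -> exec W P c2 s2 s3 t2 q2 ->
    exec W P (Seq c1 c2) s1 s3 (t1 + t2) (q1 ++ q2)
| ExIf s s' b c1 c2 t q :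
    exec W P (if beval s b then c1 else c2) s s' t q ->
    exec W P (If b c1 c2) s s' t.+1 q
| ExWhileF s b c :
    ~~ beval s b ->
    exec W P (While b c) s s 1 [::]
| ExWhileT s1 s2 s3 b c t1 t2 q1 q2 :
    beval s1 b ->
    exec W P c s1 s2 t1 q1 -> exec W P (While b c) s2 s3 t2 q2 ->
    exec W P (While b c) s1 s3 (t1 + t2).+1 (q1 ++ q2)
| ExQuery s a b x (q : instance P) :
    valid q ->
    stores (iarr s a) (enc_words q) -> stores (rarr s b) (enc_reals q) ->
    (answer q <= W)%N ->
    exec W P (Query a b x) s (set_ivar s x (answer q)) 1 [:: isize q].

(* P1 <<<_f P2.  One program solves all instances of P1, leaving the answer in
   word variable 0, with at most k queries to P2.  Words are polynomially
   bounded in n, i.e. have O(log n) bits.  The linear bound on the queried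
   instances and the bound O(f n) on the time are asymptotic in n. *)
Definition reducible (f : nat -> R) (P1 P2 : problem R) : Prop :=
  exists (c : cmd) (d k C n0 : nat),
  forall x : instance P1, valid x ->
  exists (s : state) (t : nat) (qs : seq nat),
  [/\ exec ((isize x + 2) ^ d)%N P2 c (init x) s t qs,
      ivar s 0 = answer x,
      (size qs <= k)%N &
      (n0 <= isize x)%N ->
        (forall m, m \in qs -> (m <= C * isize x)%N) /\
        t%:R <= C%:R * f (isize x)].

End Machine.

(** * 3SUM *)

Definition threesum_yes (S : seq int) : Prop :=
  exists a b c : int, [/\ a \in S, b \in S, c \in S & a + b + c = 0].

(* A set of integers is given as a duplicate-free list, in any order. *)
Definition threesum (R : realType) : problem R :=
  @Problem R (seq int)
    (fun S => uniq S)
    (fun S => size S)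
    (fun S => [:: size S])
    (fun S => [seq z%:~R | z <- S])
    (fun S => nat_of_bool `[< threesum_yes S >]).

(** * 2.5D terrains and prickliness *)

Section Terrain.
Variable R : realType.

(* ((x, y), z); the first projection is the projection to the xy-plane. *)
Definition point3 : Type := ((R * R) * R)%type.

Definition dot3 (u w : point3) : R :=
  u.1.1 * w.1.1 + u.1.2 * w.1.2 + u.2 * w.2.

Record terrain := Terrain {
  verts : seq point3;
  tris : seq (nat * nat * nat) }.

Implicit Types (T : terrain) (t : nat * nat * nat).

Definition vertex T (i : nat) : point3 := nth ((0, 0), 0) (verts T) i.
Definition proj T (i : nat) : R * R := (vertex T i).1.

Definition corners t : seq nat := [:: t.1.1; t.1.2; t.2].

(* Convex hull; in particular, the hull of no points is empty. *)
Definition hull (l : seq (R * R)) : set (R * R) :=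
  [set p | exists a : nat -> R,
    [/\ forall i, 0 <= a i,
        \sum_(i < size l) a i = 1 &
        p = \sum_(i < size l) a i *: nth (0, 0) l i]].

(* The projection to the xy-plane of the face spanned by the vertices in l. *)
Definition face T (l : seq nat) : set (R * R) := hull (map (proj T) l).

Definition domain T : set (R * R) :=
  [set p | exists2 t, t \in tris T & face T (corners t) p].

Definition orient (p q r : R * R) : R :=
  (q.1 - p.1) * (r.2 - p.2) - (q.2 - p.2) * (r.1 - p.1).

(* The projected triangles are nondegenerate and meet only in common faces,
   so that the surface is xy-monotone and triangulated.  The last two
   conditions say that the domain is a topological disk: the surface is
   connected, is not pinched at a vertex, and has no holes. *)
Definition is_terrain T : Prop :=
  [/\ tris T != [::],
      forall t, t \in tris T ->
        (forall i, i \in corners t -> (i < size (verts T))%N) /\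
        orient (proj T t.1.1) (proj T t.1.2) (proj T t.2) != 0,
      forall i, (i < size (verts T))%N ->
        exists2 t, t \in tris T & i \in corners t,
      forall i j, (i < j < size (tris T))%N ->
        let t := nth (0, 0, 0)%N (tris T) i in
        let t' := nth (0, 0, 0)%N (tris T) j in
        ~~ perm_eq (corners t) (corners t') /\
        face T (corners t) `&` face T (corners t') =
          face T [seq v <- corners t | v \in corners t'] &
      connected (interior (domain T)) /\ connected (~` domain T)].

Definition neighbors T (i j : nat) : bool :=
  (i != j) && has (fun t => (i \in corners t) && (j \in corners t)) (tris T).

(* The union of the projected edges. *)
Definition drawing T : set (R * R) :=
  [set p | exists i j, neighbors T i j /\ face T [:: i; j] p].

(* A face is a connected component of the complement of the drawing. *)
Definition unbounded_face T : set (R * R) :=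
  [set p | ~ bounded_set (connected_component (~` drawing T) p)].

Definition internal T (i : nat) : Prop :=
  ~ closure (unbounded_face T) (proj T i).

(* The non-vertical plane through the vertex has slopes a and b. *)
Definition convex_vertex T (i : nat) : Prop :=
  exists a b : R, forall j, neighbors T i j ->
    (vertex T j).2 < (vertex T i).2
      + a * ((proj T j).1 - (proj T i).1)
      + b * ((proj T j).2 - (proj T i).2).

Definition local_max T (w : point3) (i : nat) : Prop :=
  forall j, neighbors T i j -> dot3 (vertex T j) w < dot3 (vertex T i) w.

Definition prickliness_dir T (w : point3) : nat :=
  #|[set i : 'I_(size (verts T)) |
      `[< [/\ internal T i, convex_vertex T i & local_max T w i] >] ]%SET|.

(* prickliness_dir T w is at most the number of vertices, so this is the
   maximum over all w. *)
Definition prickliness T : nat :=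
  (\max_(k < (size (verts T)).+1 |
      `[< exists w : point3, prickliness_dir T w = k >]) k)%N.

(* The two leading counts make the encoding prefix-free, hence memory holds at
   most one terrain at a given place. *)
Definition prickliness_problem : problem R :=
  @Problem R terrain
    is_terrain
    (fun T => size (verts T))
    (fun T => [:: size (verts T), size (tris T) & flatten (map corners (tris T))])
    (fun T => flatten [seq [:: v.1.1; v.1.2; v.2] | v <- verts T])
    prickliness.

End Terrain.

(* Main.v *)
(* Put w = (p, q, 1) and let S be the given set.  The numbers a, b, c of S sum to 0 iff the
   lines p - q = a, -p - q = b and -q = -c/2 are concurrent.  Each of these 3|S| lines becomes
   a peak of the terrain that is a local maximum exactly for the directions w in a thin strip
   around a segment of the line: the peak lies just above the edge between two consecutive
   points P_j and P_(j+1) of a polygonal chain, whose slope encodes the line, and the third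
   neighbour of the peak is a vertex A far below.  Strips of parallel lines are disjoint, as S
   has no duplicates, so at most three peaks count at a time, and three do iff S is a
   yes-instance.

   All other vertices are partitioned into cliques of the triangulation, each of which contains
   a very high spike.  A clique has at most one local maximum, and the spikes are local maxima
   in all relevant directions.  Hence the prickliness is at least 3 plus the number of cliques
   iff S is a yes-instance; no vertex has to be shown to be on the boundary.

   The triangulation arises from one triangle by inserting points into triangles, which gives
   its validity by induction, and the order of S is irrelevant, so linear time suffices. *)
Require Import Defs.
From mathcomp Require Import all_boot all_order all_algebra.
From mathcomp Require Import all_classical all_reals all_analysis.
From mathcomp Require Import ring lra zify.
(* [proj] and others are redefined by the analysis library. *)
Import Defs.

Set Implicit Arguments.
Unset Strict Implicit.
Unset Printing Implicit Defensive.

Import Order.TTheory GRing.Theory Num.Theory.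
Import numFieldNormedType.Exports.

Local Open Scope classical_set_scope.
Local Open Scope ring_scope.

(** * Barycentric coordinates *)

(** A chain step is (dx, -1, -sigma) with dx running through 1, -1, 0, so the two ends of an edge
    are level in direction (p, q, 1) exactly on the line of its gadget. The third line is halved
    because (p - q) + (-p - q) = 2(-q). A peak has to be inserted strictly inside a triangle, so the
    weight [eta] moves it off the edge towards A. Together with its lift of 1/16 this turns the line
    into a strip: a local maximum forces the level difference of the two ends below w.2 / 4.
    Combining three such differences with coefficients 1, 1, -2 leaves |a + b + c| < 1, and
    integrality does the rest. For a yes-instance one direction suffices, the exact point of
    concurrency. It satisfies |p|, |q| <= [bigQ], so heights have to win over horizontal terms only
    on this box: [bigH] is chosen for that, and [eta] so small that the pull towards A costs less
    than the lift. The upper bound on the count must hold for every w, even with w.2 <= 0; it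
    therefore rests only on adjacency and on the strip inequality. *)

Section Barycentric.
Variable R : realType.
Implicit Types (f : nat -> R * R) (t : nat * nat * nat) (l : seq nat).

(** Weights indexed by vertex numbers instead of list positions can be compared between triangles
    that share vertices. *)
Lemma hullP f l p : uniq l ->
  hull (map f l) p <-> exists a : nat -> R,
    [/\ forall v, 0 <= a v, \sum_(v <- l) a v = 1 & p = \sum_(v <- l) a v *: f v].
Proof.
move=> ul; split=> -[a [a0 a1 pE]].
- exists (fun v => a (index v l)); split=> //.
  + rewrite -a1 size_map (big_nth 0%N) big_mkord; apply: eq_bigr => i _.
    by rewrite index_uniq.
  + rewrite pE size_map (big_nth 0%N) big_mkord; apply: eq_bigr => i _.
    by rewrite index_uniq // (nth_map 0%N).
- exists (fun i => a (nth 0%N l i)); split=> //.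
  + by rewrite size_map -a1 (big_nth 0%N) big_mkord.
  + rewrite pE size_map (big_nth 0%N) big_mkord; apply: eq_bigr => i _.
    by rewrite (nth_map 0%N).
Qed.

Lemma hull_filter f l (a : nat -> R) (P : pred nat) : uniq l ->
  (forall v, 0 <= a v) -> \sum_(v <- l) a v = 1 ->
  (forall v, v \in l -> ~~ P v -> a v = 0) ->
  hull (map f [seq v <- l | P v]) (\sum_(v <- l) a v *: f v).
Proof.
move=> ul a0 a1 aP; apply/hullP; first exact: filter_uniq.
exists a; split=> //.
- rewrite -a1 [RHS](bigID P) /= [X in _ = _ + X]big_seq_cond.
  rewrite [X in _ = _ + X]big1 ?addr0 ?big_filter//.
  by move=> v /andP[vl Pv]; exact: aP.
- rewrite (bigID P) /= [X in _ + X]big_seq_cond [X in _ + X]big1 ?addr0 ?big_filter//.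
  by move=> v /andP[vl Pv]; rewrite aP// scale0r.
Qed.

Lemma hull_sub f l l' : uniq l -> uniq l' -> {subset l <= l'} ->
  hull (map f l) `<=` hull (map f l').
Proof.
move=> ul ul' sub p /(hullP _ _ ul)[a [a0 a1 pE]]; apply/hullP => //.
have pl : perm_eq [seq v <- l' | v \in l] l.
  apply: uniq_perm => //; first exact: filter_uniq.
  by move=> v; rewrite mem_filter; case: (boolP (v \in l)) => //= /sub ->.
exists (fun v => if v \in l then a v else 0); split.
- by move=> v; case: ifP.
- by rewrite -big_mkcond/= -big_filter (perm_big _ pl).
- rewrite pE -(perm_big _ pl)/= big_filter big_mkcond; apply: eq_bigr => v _.
  by case: ifP => // _; rewrite scale0r.
Qed.

Definition nondegenerate f t : Prop := orient (f t.1.1) (f t.1.2) (f t.2) != 0.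

Definition meet_properly f t t' : Prop :=
  ~~ perm_eq (corners t) (corners t') /\
  hull (map f (corners t)) `&` hull (map f (corners t')) =
    hull (map f [seq v <- corners t | v \in corners t']).

Lemma nondegenerate_uniq f t : nondegenerate f t -> uniq (corners t).
Proof.
case: t => -[a b] c; rewrite /nondegenerate /corners /=.
rewrite !inE => ot; apply/and3P; split => //; last first.
  by apply: contraNneq ot => ->; apply/eqP; rewrite /orient; ring.
by apply/negP => /orP[] /eqP E; move: ot; rewrite E /orient; apply/negP;
  rewrite negbK; apply/eqP; ring.
Qed.

Lemma meet_properlyC f t t' : nondegenerate f t -> nondegenerate f t' ->
  meet_properly f t t' -> meet_properly f t' t.
Proof.
move=> /nondegenerate_uniq ut /nondegenerate_uniq ut' [np fE].
split; first by rewrite perm_sym.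
rewrite setIC fE; apply/seteqP.
by split; apply: hull_sub; rewrite ?filter_uniq // => v;
  rewrite !mem_filter andbC.
Qed.

(** The shared face always lies in both triangles, so only the other inclusion is at stake: a common
    point must put no weight on an unshared corner. *)
Lemma meet_properlyI f t t' : nondegenerate f t -> nondegenerate f t' ->
  ~~ perm_eq (corners t) (corners t') ->
  (forall a, (forall v, 0 <= a v) -> \sum_(v <- corners t) a v = 1 ->
     hull (map f (corners t')) (\sum_(v <- corners t) a v *: f v) ->
     forall v, v \in corners t -> v \notin corners t' -> a v = 0) ->
  meet_properly f t t'.
Proof.
move=> /nondegenerate_uniq ut /nondegenerate_uniq ut' np H; split => //.
apply/seteqP; split=> [p [/(hullP _ _ ut)[a [a0 a1 pE]] p2]|p pf].
  rewrite pE; apply: hull_filter => //; apply: H => //; by rewrite -pE.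
by split; move: p pf; apply: hull_sub; rewrite ?filter_uniq // => v;
  rewrite mem_filter => /andP[].
Qed.

Lemma barycentric_inj f t (a a' : nat -> R) : nondegenerate f t ->
  \sum_(v <- corners t) a v = 1 -> \sum_(v <- corners t) a' v = 1 ->
  \sum_(v <- corners t) a v *: f v = \sum_(v <- corners t) a' v *: f v ->
  {in corners t, a =1 a'}.
Proof.
case: t => -[x y] z; rewrite /nondegenerate /orient /corners /=.
rewrite !big_cons !big_nil !addr0.
case: (f x) (f y) (f z) => [x1 x2] [y1 y2] [z1 z2] /= ot s s' [e1 e2].
have ey : a y = a' y.
  apply/eqP; rewrite -subr_eq0; apply/eqP.
  apply: (mulIf ot); rewrite mul0r.
  have ax : a x = 1 - a y - a z by rewrite -s; ring.
  have ax' : a' x = 1 - a' y - a' z by rewrite -s'; ring.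
  move: e1 e2; rewrite ax ax' /GRing.scale /= => e1 e2.
  (* Cramer's rule; the two differences on the right vanish by [e1] and [e2]. *)
  have -> : (a y - a' y) * ((y1 - x1) * (z2 - x2) - (y2 - x2) * (z1 - x1)) =
    (((1 - a y - a z) * x1 + (a y * y1 + a z * z1)) -
     ((1 - a' y - a' z) * x1 + (a' y * y1 + a' z * z1))) * (z2 - x2) -
    (((1 - a y - a z) * x2 + (a y * y2 + a z * z2)) -
     ((1 - a' y - a' z) * x2 + (a' y * y2 + a' z * z2))) * (z1 - x1) by ring.
  by rewrite e1 e2 !subrr !mul0r subrr.
have ez : a z = a' z.
  apply/eqP; rewrite -subr_eq0; apply/eqP.
  apply: (mulIf ot); rewrite mul0r.
  have ax : a x = 1 - a y - a z by rewrite -s; ring.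
  have ax' : a' x = 1 - a' y - a' z by rewrite -s'; ring.
  move: e1 e2; rewrite ax ax' /GRing.scale /= => e1 e2.
  have -> : (a z - a' z) * ((y1 - x1) * (z2 - x2) - (y2 - x2) * (z1 - x1)) =
    (((1 - a y - a z) * x2 + (a y * y2 + a z * z2)) -
     ((1 - a' y - a' z) * x2 + (a' y * y2 + a' z * z2))) * (y1 - x1) -
    (((1 - a y - a z) * x1 + (a y * y1 + a z * z1)) -
     ((1 - a' y - a' z) * x1 + (a' y * y1 + a' z * z1))) * (y2 - x2) by ring.
  by rewrite e1 e2 !subrr !mul0r subrr.
have ex : a x = a' x by apply: (addIr (a y + a z)); rewrite s ey ez s'.
by move=> v; rewrite !inE => /or3P[] /eqP ->.
Qed.

End Barycentric.

(** * Inserting a point into a triangle *)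

Section Insertion.
Variable R : realType.
Implicit Types (f : nat -> R * R) (t : nat * nat * nat) (l : seq nat).

Definition repl t (u v : nat) : nat * nat * nat :=
  let g x := if x == u then v else x in (g t.1.1, g t.1.2, g t.2).

Lemma corners_repl t u v :
  corners (repl t u v) = [seq if x == u then v else x | x <- corners t].
Proof. by []. Qed.

Lemma mem_repl t u v x : v \notin corners t -> u \in corners t ->
  (x \in corners (repl t u v)) = (x == v) || (x != u) && (x \in corners t).
Proof.
move=> vt ut; rewrite corners_repl; apply/mapP/orP.
  move=> [y yt ->]; case: ifPn => [|yu]; first by left.
  by right; rewrite yu.
move=> [/eqP ->|/andP[xu xt]]; first by exists u => //; rewrite eqxx.
by exists x => //; rewrite (negbTE xu).
Qed.

Definition split3 t (v : nat) := [:: repl t t.1.1 v; repl t t.1.2 v; repl t t.2 v].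

Lemma split3P t v t' :
  reflect (exists2 u, u \in corners t & t' = repl t u v) (t' \in split3 t v).
Proof.
apply: (iffP idP).
  by rewrite /split3 !inE => /or3P[] /eqP ->; eexists => //; rewrite !inE eqxx ?orbT.
by move=> [u]; rewrite !inE => /or3P[] /eqP -> ->; rewrite eqxx ?orbT.
Qed.

Section Inside.
Variables (f : nat -> R * R) (t : nat * nat * nat) (v : nat) (lam : nat -> R).
Hypothesis nt : nondegenerate f t.
Hypothesis vt : v \notin corners t.
Hypothesis lam0 : {in corners t, forall x, 0 < lam x}.
Hypothesis lam1 : \sum_(x <- corners t) lam x = 1.
Hypothesis fv : f v = \sum_(x <- corners t) lam x *: f x.

Let ut := nondegenerate_uniq nt.

(* Turns weights on the corners of [repl t u v] into weights on those of [t]. *)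
Definition pull (u : nat) (m : nat -> R) (x : nat) : R :=
  (x != u)%:R * m x + m v * lam x.

Lemma sum_pull u m : u \in corners t ->
  \sum_(x <- corners t) pull u m x = \sum_(y <- corners (repl t u v)) m y.
Proof.
move=> ut'; rewrite big_split/= -mulr_sumr lam1 mulr1 corners_repl big_map.
rewrite (bigD1_seq u)//= eqxx mul0r add0r [RHS](bigD1_seq u)//= eqxx addrC.
by congr (_ + _); apply: eq_bigr => x /negbTE ->; rewrite mul1r.
Qed.

Lemma sum_pullZ u m : u \in corners t ->
  \sum_(x <- corners t) pull u m x *: f x =
  \sum_(y <- corners (repl t u v)) m y *: f y.
Proof.
move=> ut'; under eq_bigr do rewrite scalerDl.
rewrite big_split/=; under [X in _ + X]eq_bigr do rewrite -scalerA.
rewrite -scaler_sumr -fv corners_repl big_map.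
rewrite (bigD1_seq u)//= eqxx mul0r scale0r add0r [RHS](bigD1_seq u)//= eqxx addrC.
by congr (_ + _); apply: eq_bigr => x /negbTE ->; rewrite mul1r.
Qed.

Lemma pull_ge0 u m : (forall x, 0 <= m x) -> {in corners t, forall x, 0 <= pull u m x}.
Proof.
move=> m0 x xt; rewrite /pull addr_ge0// mulr_ge0//.
by apply: ltW; exact: lam0.
Qed.

(** Replacing the corner [u] by [v] multiplies the signed area by the coordinate [lam u] of [v]. *)
Lemma nondegenerate_repl u : u \in corners t -> nondegenerate f (repl t u v).
Proof.
move=> ut'; suff E : orient (f (repl t u v).1.1) (f (repl t u v).1.2) (f (repl t u v).2)
   = lam u * orient (f t.1.1) (f t.1.2) (f t.2).
  by rewrite /nondegenerate E mulf_neq0//; apply: lt0r_neq0; exact: lam0.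
move: ut lam1 fv ut'; case: (t) => -[x y] z.
rewrite /corners /= !big_cons !big_nil !addr0 !inE => /and3P[/norP[xy xz] yz _].
move=> l1 fE; have lx : lam x = 1 - lam y - lam z by rewrite -l1; ring.
rewrite /repl/= => /or3P[] /eqP ->;
  rewrite ?eqxx ?(negbTE xy) ?(negbTE xz) ?(negbTE yz) ?[y == x]eq_sym ?[z == x]eq_sym
    ?[z == y]eq_sym ?(negbTE xy) ?(negbTE xz) ?(negbTE yz) fE;
  case: (f x) (f y) (f z) => [x1 x2] [y1 y2] [z1 z2];
  rewrite /orient /= /GRing.scale /= lx; ring.
Qed.

Lemma repl_not_perm u l : ~~ (v \in l) -> u \in corners t ->
  ~~ perm_eq (corners (repl t u v)) l.
Proof.
move=> vl ut'; apply: contraNN vl => /perm_mem <-.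
by rewrite mem_repl// eqxx.
Qed.

(** A common point lies on the face that [t] shares with [t'], so its weight on [t] vanishes at a
    corner outside [t']. The inserted point contributes a positive multiple of [m v] there; hence
    [m v] is zero and the remaining weights are those on [t]. *)
Lemma meet_repl_old u t' : u \in corners t -> nondegenerate f t' ->
  v \notin corners t' -> meet_properly f t t' -> meet_properly f (repl t u v) t'.
Proof.
move=> ut' nt' vt' [np tt'].
have ur := nondegenerate_repl ut'.
apply: meet_properlyI => //; first exact: repl_not_perm.
move=> m m0 m1 mt'.
have : (hull (map f (corners t)) `&` hull (map f (corners t')))
    (\sum_(y <- corners (repl t u v)) m y *: f y).
  split=> //; apply/hullP => //.
  exists (fun x => if x \in corners t then pull u m x else 0); split.
  - by move=> x; case: ifP => // xt; exact: pull_ge0.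
  - by rewrite -[RHS]m1 -(sum_pull m ut'); apply: eq_big_seq => x ->.
  - by rewrite -(sum_pullZ m ut'); apply: eq_big_seq => x ->.
rewrite tt' => /hullP[]; first exact: filter_uniq.
move=> k [k0 k1 kE].
pose k' x := if x \in corners t' then k x else 0.
have kp : {in corners t, k' =1 pull u m}.
  apply: (barycentric_inj nt).
  - by rewrite -big_mkcond/= -big_filter.
  - by rewrite sum_pull.
  - rewrite sum_pullZ// kE big_filter [RHS]big_mkcond; apply: eq_bigr => x _.
    by rewrite /k'; case: ifP; rewrite ?scale0r.
(* Otherwise the three corners of [t] would be those of [t']. *)
have [x0 x0t x0t'] : exists2 x, x \in corners t & x \notin corners t'.
  apply: contrapT => H; move/negP: np; apply.
  apply: uniq_perm => //; first exact: nondegenerate_uniq nt'.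
  apply: (uniq_min_size ut _ _).2 => //.
  move=> x xt; apply: contrapT => /negP xt'; apply: H; by exists x.
have mv : m v = 0.
  have := kp _ x0t; rewrite /k' (negbTE x0t') /pull => /esym/eqP.
  rewrite paddr_eq0 ?mulr_ge0// ?(ltW (lam0 x0t))//.
  by move=> /andP[_]; rewrite mulf_eq0 (gt_eqF (lam0 x0t)) orbF => /eqP.
move=> y; rewrite mem_repl// => /orP[/eqP ->//|/andP[yu yt] yt'].
have := kp _ yt; rewrite /k' (negbTE yt') /pull mv yu mul0r addr0 mul1r.
by move=> <-.
Qed.

(** Both representations of a common point pull back to the same weights on [t]. At [u] and [u']
    this bounds [m v] and [m' v] by each other; they are equal, and nothing is left for [u']. *)
Lemma meet_repl_repl u u' : u \in corners t -> u' \in corners t -> u != u' ->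
  meet_properly f (repl t u v) (repl t u' v).
Proof.
move=> ut1 ut2 uu'.
have nr1 := nondegenerate_repl ut1; have nr2 := nondegenerate_repl ut2.
have u'r : u' \in corners (repl t u v) by rewrite mem_repl// ut2 [u' == u]eq_sym uu' orbT.
have u'v : u' != v by apply: contraNneq vt => <-.
apply: meet_properlyI => //.
  apply/negP => /perm_mem /(_ u'); rewrite u'r mem_repl// eqxx/= orbF => /esym E.
  by rewrite E in u'v.
move=> m m0 m1 /hullP[]; first exact: nondegenerate_uniq nr2.
move=> m' [m'0 m'1 mE] y.
have pp : {in corners t, pull u m =1 pull u' m'}.
  apply: (barycentric_inj nt).
  - by rewrite sum_pull.
  - by rewrite sum_pull.
  - by rewrite !sum_pullZ.
have := pp _ ut1; have := pp _ ut2; rewrite /pull !eqxx [u' == u]eq_sym uu' /= !mul0r !add0r !mul1r.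
move=> e2 e1.
have le1 : m' v <= m v.
  by rewrite -(ler_pM2r (lam0 ut1)) e1 lerDr.
have le2 : m v <= m' v.
  by rewrite -(ler_pM2r (lam0 ut2)) -e2 lerDr.
have mu' : m u' = 0.
  apply: (addIr (m v * lam u')); rewrite e2 add0r; congr (_ * _).
  by apply/eqP; rewrite eq_le le1 le2.
rewrite !mem_repl//; have [->|yv] := eqVneq y v => //=.
move=> /andP[yu yt]; rewrite yt andbT negbK => /eqP ->.
exact: mu'.
Qed.

Lemma hull_split3 : hull (map f (corners t)) =
  [set p | exists2 t', t' \in split3 t v & hull (map f (corners t')) p].
Proof.
apply/seteqP; split=> [p /(hullP _ _ ut)[a [a0 a1 pE]]|p [t' /split3P[u ut' ->]]].
  (* The new point receives the largest multiple of [lam] that can be subtracted from the weights; a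
     corner attaining the minimal ratio drops out. *)
  have [u ut' umin] : exists2 u, u \in corners t &
      {in corners t, forall x, a u / lam u <= a x / lam x}.
    have [x xt] : exists x, x \in corners t by exists t.1.1; rewrite !inE eqxx.
    pose g (i : 'I_3) := a (nth 0%N (corners t) i) / lam (nth 0%N (corners t) i).
    pose i0 := [arg min_(i < ord0) g i]%O.
    exists (nth 0%N (corners t) i0); first by rewrite mem_nth.
    move=> y yt; have yi : (index y (corners t) < 3)%N.
      by rewrite -[3%N]/(size (corners t)) index_mem.
    have := arg_minP (i0 := ord0) (P := predT) g isT.
    rewrite /i0; case: arg_minP => // i _ /(_ (Ordinal yi) isT) H _.
    by move: H; rewrite /g /= nth_index.
  pose c := a u / lam u.
  have c0 : 0 <= c by rewrite divr_ge0// ltW// lam0.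
  exists (repl t u v); first by apply/split3P; exists u.
  pose m x := if x == v then c else if x \in corners t then a x - c * lam x else 0.
  have mp : {in corners t, pull u m =1 a}.
    move=> x xt; rewrite /pull /m eqxx xt.
    have -> : (x == v) = false by apply: contraNF vt => /eqP <-.
    have [->|xu] := eqVneq x u; last by rewrite /=; ring.
    by rewrite mul0r add0r /c divfK// gt_eqF// lam0.
  apply/hullP; first exact: nondegenerate_uniq (nondegenerate_repl ut').
  exists m; split.
  - move=> x; rewrite /m; case: ifP => // _; case: ifP => // xt.
    by rewrite subr_ge0 -ler_pdivlMr ?lam0//; exact: umin.
  - by rewrite -sum_pull// -[RHS]a1; exact: eq_big_seq.
  - by rewrite -sum_pullZ// pE; apply: eq_big_seq => x xt; rewrite mp.
have ur := nondegenerate_uniq (nondegenerate_repl ut').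
move=> /(hullP _ _ ur)[m [m0 m1 pE]]; apply/hullP => //.
exists (fun x => if x \in corners t then pull u m x else 0); split.
- by move=> x; case: ifP => // xt; exact: pull_ge0.
- by rewrite -[RHS]m1 -(sum_pull m ut'); apply: eq_big_seq => x ->.
- by rewrite pE -(sum_pullZ m ut'); apply: eq_big_seq => x ->.
Qed.

End Inside.

Definition triangulation f (D : set (R * R)) (ts : seq (nat * nat * nat)) : Prop :=
  [/\ forall t, t \in ts -> nondegenerate f t,
      pairwise (fun t t' => `[< meet_properly f t t' >]) ts &
      D = [set p | exists2 t, t \in ts & hull (map f (corners t)) p]].

(** Symmetry is asked for on the list only, as [meet_properly] is known to be symmetric just for
    nondegenerate triangles; it is carried through the induction on swaps. *)
Lemma pairwise_perm_sym (T : eqType) (r : rel T) (s s' : seq T) :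
  {in s &, symmetric r} -> perm_eq s s' -> pairwise r s -> pairwise r s'.
Proof.
move=> rs ps pw; suff [] : {in s' &, symmetric r} /\ pairwise r s' by [].
pose P (l : seq T) := {in l &, symmetric r} /\ pairwise r l.
apply: (@catCA_perm_ind _ P _ s s') => // s1 s2 s3 [sr p].
have sub (l : seq T) : {subset l <= s1 ++ s2 ++ s3} -> {in l &, symmetric r}.
  by move=> ls x y /ls xs /ls ys; exact: sr.
split; first by apply: sub => x; rewrite !mem_cat orbCA.
move: p; rewrite !pairwise_cat !allrel_catr => /and3P[/andP[r12 r13] p1 /and3P[r23 p2 p3]].
rewrite r13 r23 p1 p2 p3 !andbT /=; apply/allrelP => x y xs ys.
by rewrite sr ?mem_cat ?xs ?ys ?orbT//; move/allrelP : r12; exact.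
Qed.

Lemma triangulation_perm f D ts ts' : perm_eq ts ts' ->
  triangulation f D ts -> triangulation f D ts'.
Proof.
move=> pts [nd pw DE]; split.
- by move=> t; rewrite -(perm_mem pts); exact: nd.
- apply: pairwise_perm_sym pts pw => t t' /nd nt /nd nt'.
  by apply/asboolP/asboolP; exact: meet_properlyC.
- rewrite DE; apply/seteqP.
  by split=> p [t tt pt]; exists t => //; rewrite ?(perm_mem pts)// -(perm_mem pts).
Qed.

Lemma triangulation_insert f D t ts v (lam : nat -> R) :
  triangulation f D (t :: ts) ->
  (forall t', t' \in t :: ts -> v \notin corners t') ->
  {in corners t, forall x, 0 < lam x} ->
  \sum_(x <- corners t) lam x = 1 ->
  f v = \sum_(x <- corners t) lam x *: f x ->
  triangulation f D (split3 t v ++ ts).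
Proof.
move=> [nd pw DE] fresh lam0 lam1 fv.
have nt : nondegenerate f t by apply: nd; rewrite mem_head.
have ut := nondegenerate_uniq nt.
have vt : v \notin corners t by apply: fresh; rewrite mem_head.
move: pw; rewrite pairwise_cons => /andP[/allP tts pts].
split.
- move=> t'; rewrite mem_cat => /orP[/split3P[u ut' ->]|t'ts].
    exact: (nondegenerate_repl (lam := lam)).
  by apply: nd; rewrite in_cons t'ts orbT.
- rewrite pairwise_cat pts andbT; apply/andP; split.
    apply/allrelP => t1 t2 /split3P[u ut' ->] t2ts; apply/asboolP.
    have t2ts' : t2 \in t :: ts by rewrite in_cons t2ts orbT.
    apply: (meet_repl_old nt vt lam0 lam1 fv) => //; [exact: nd|exact: fresh|].
    by apply/asboolP; exact: tts.
  move: ut; rewrite /= !inE => /and3P[/norP[xy xz] yz _].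
  rewrite /split3 /= !andbT; apply/andP; split; first (apply/andP; split).
  + by apply/asboolP; apply: (meet_repl_repl nt vt lam0 lam1 fv);
      rewrite // !inE eqxx ?orbT.
  + by apply/asboolP; apply: (meet_repl_repl nt vt lam0 lam1 fv);
      rewrite // !inE eqxx ?orbT.
  + by apply/asboolP; apply: (meet_repl_repl nt vt lam0 lam1 fv);
      rewrite // !inE eqxx ?orbT.
- rewrite DE; apply/seteqP; split=> p [t' t't pt'].
    move: t't pt'; rewrite in_cons => /orP[/eqP ->|t'ts].
      rewrite (hull_split3 nt vt lam0 lam1 fv) => -[t'' t''t pt''].
      by exists t'' => //; rewrite mem_cat t''t.
    by move=> ?; exists t' => //; rewrite mem_cat t'ts orbT.
  move: t't; rewrite mem_cat => /orP[t't|t't].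
    exists t; first by rewrite mem_head.
    by rewrite (hull_split3 nt vt lam0 lam1 fv); exists t'.
  by exists t' => //; rewrite in_cons t't orbT.
Qed.

End Insertion.

(** * Topology of a triangle *)

Section Plane.
Variable R : realType.
Implicit Types (a b c p q : R * R) (A : set (R * R)).

Definition segment_closed A := forall x y, A x -> A y ->
  forall s : R, 0 <= s <= 1 -> A ((1 - s) *: x + s *: y).

Lemma segment_closed_connected A : segment_closed A -> connected A.
Proof.
move=> cA; have [[x0 Ax0]|/nonemptyPn ->] := pselect (A !=set0); last exact: connected0.
have -> : A = \bigcup_(y in A) [set (1 - s) *: x0 + s *: y | s in `[0, 1]%classic].
  apply/seteqP; split=> [y Ay|z [y Ay [s]]].
    exists y => //; exists 1; first by rewrite /= in_itv /= lexx ler01.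
    by rewrite subrr scale0r add0r scale1r.
  by rewrite /= in_itv /= => s01 <-; exact: cA.
apply: bigcup_connected.
  exists x0 => y Ay; exists 0; first by rewrite /= in_itv /= lexx ler01.
  by rewrite subr0 scale1r scale0r addr0.
move=> y Ay; apply: connected_continuous_connected; first exact: segment_connected.
apply: continuous_subspaceT => s.
apply: cvgD; apply: cvgZr_tmp; [apply: cvgB; [exact: cvg_cst|exact: cvg_id]|exact: cvg_id].
Qed.

Lemma segment_closed_interior A : segment_closed A -> segment_closed (interior A).
Proof.
move=> cA x y /nbhs_ballP[e e0 xe] /nbhs_ballP[d d0 yd] s s01.
apply/nbhs_ballP; exists (Order.min e d) => /=; first by rewrite lt_min e0 d0.
move=> u; rewrite -ball_normE /= => ub.
set z := (1 - s) *: x + s *: y in ub *.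
(* A point near [z] is the same combination of [x] and [y], both translated by [u - z]. *)
have -> : u = (1 - s) *: (x + (u - z)) + s *: (y + (u - z)).
  by rewrite [(1 - s) *: (_ + _)]scalerDr [s *: (_ + _)]scalerDr addrACA -/z -scalerDl
    subrK scale1r addrC subrK.
move: ub; rewrite lt_min => /andP[ue ud].
apply: cA => //; [apply: xe|apply: yd]; rewrite -ball_normE /= opprD addrA subrr add0r normrN.
  by rewrite distrC.
by rewrite distrC.
Qed.

Lemma hull2 a b (x y : R) : 0 <= x -> 0 <= y -> x + y = 1 ->
  hull [:: a; b] (x *: a + y *: b).
Proof.
move=> x0 y0 xy; exists (fun i => if i == 0%N then x else y).
by split; [move=> i; case: ifP | rewrite /= !big_ord_recl big_ord0 /= addr0
  | rewrite /= !big_ord_recl big_ord0 /= addr0].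
Qed.

Lemma hull3P a b c p : hull [:: a; b; c] p <->
  exists x y z, [/\ 0 <= x, 0 <= y, 0 <= z, x + y + z = 1 &
    p = x *: a + y *: b + z *: c].
Proof.
split=> [[w [w0 w1 pE]]|[x [y [z [x0 y0 z0 xyz pE]]]]].
  exists (w 0), (w 1%N), (w 2%N); split => //.
    by rewrite -w1 /= !big_ord_recl big_ord0 /= addr0 addrA.
  by rewrite pE /= !big_ord_recl big_ord0 /= addr0 addrA.
exists (fun i => if i == 0%N then x else if i == 1%N then y else z).
split; first by move=> i; do 2 case: ifP => //.
  by rewrite /= !big_ord_recl big_ord0 /= addr0 addrA.
by rewrite pE /= !big_ord_recl big_ord0 /= addr0 addrA.
Qed.

Lemma orientC a b c : orient a b c = orient b c a.
Proof. rewrite /orient; ring. Qed.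

Lemma orient_affine a b p q (s : R) :
  orient ((1 - s) *: p + s *: q) a b = (1 - s) * orient p a b + s * orient q a b.
Proof. rewrite /orient /= /GRing.scale /=; ring. Qed.

Lemma continuous_orient a b : continuous (fun p => orient p a b).
Proof.
move=> p; rewrite /orient.
have c1 : (fun p : R * R => p.1) q @[q --> p] --> p.1 by exact: cvg_fst.
have c2 : (fun p : R * R => p.2) q @[q --> p] --> p.2 by exact: cvg_snd.
by apply: cvgB; apply: cvgM; apply: cvgB => //; exact: cvg_cst.
Qed.

(** The barycentric coordinate of [p] at the corner [a]. *)
Definition bary a b c p : R := orient p b c / orient a b c.

Section Triangle.
Variables a b c : R * R.
Hypothesis abc : orient a b c != 0.

Let bca : orient b c a != 0. Proof. by rewrite -orientC. Qed.
Let cab : orient c a b != 0. Proof. by rewrite orientC. Qed.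

Lemma bary_sum p : bary a b c p + bary b c a p + bary c a b p = 1.
Proof.
rewrite /bary -(orientC b c a) -(orientC a b c) -!mulrDl -[RHS](divff abc).
by congr (_ / _); rewrite /orient; ring.
Qed.

Lemma bary_comb p : p = bary a b c p *: a + bary b c a p *: b + bary c a b p *: c.
Proof.
rewrite /bary -(orientC b c a) -(orientC a b c).
move: abc; case: p a b c => [p1 p2] [a1 a2] [b1 b2] [c1 c2].
rewrite /orient /= /GRing.scale /= => d0.
by congr pair; rewrite /= /scale_pair /= /GRing.scale /=; field.
Qed.

Lemma bary_affine p q (s : R) :
  bary a b c ((1 - s) *: p + s *: q) = (1 - s) * bary a b c p + s * bary a b c q.
Proof. by rewrite /bary orient_affine; ring. Qed.

(** The weights may be negative, so this also evaluates the coordinates of points outside the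
    triangle. *)
Lemma bary_of_comb (x y z : R) : x + y + z = 1 ->
  bary a b c (x *: a + y *: b + z *: c) = x.
Proof.
move=> xyz; have -> : x = 1 - y - z by rewrite -xyz; ring.
apply: (mulIf abc); rewrite /bary divfK// /orient /= /GRing.scale /=; ring.
Qed.

Lemma continuous_bary : continuous (bary a b c).
Proof.
by move=> p; apply: cvgM; [exact: continuous_orient|exact: cvg_cst].
Qed.

Lemma open_bary_gt0 : open [set p | 0 < bary a b c p].
Proof.
apply: (@open_comp _ _ (bary a b c) [set x | 0 < x]); last exact: open_gt.
by move=> p _; exact: continuous_bary.
Qed.

Lemma open_bary_lt0 : open [set p | bary a b c p < 0].
Proof.
apply: (@open_comp _ _ (bary a b c) [set x | x < 0]); last exact: open_lt.
by move=> p _; exact: continuous_bary.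
Qed.

Lemma connected_bary_lt0 : connected [set p | bary a b c p < 0].
Proof.
apply: segment_closed_connected => p q /= p0 q0 s /andP[s0 s1].
rewrite bary_affine; have [->|sn] := eqVneq s 0; first by rewrite subr0 mul1r mul0r addr0.
have : s * bary a b c q < 0 by rewrite pmulr_rlt0// lt0r sn.
have : (1 - s) * bary a b c p <= 0 by rewrite mulr_ge0_le0 ?subr_ge0// ltW.
lra.
Qed.

End Triangle.

Section TriangleDomain.
Variables a b c : R * R.
Hypothesis abc : orient a b c != 0.

Let bca : orient b c a != 0. Proof. by rewrite -orientC. Qed.
Let cab : orient c a b != 0. Proof. by rewrite orientC. Qed.

Lemma hull3_bary p : hull [:: a; b; c] p <->
  [/\ 0 <= bary a b c p, 0 <= bary b c a p & 0 <= bary c a b p].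
Proof.
split=> [/hull3P[x [y [z [x0 y0 z0 xyz ->]]]]|[x0 y0 z0]].
  split; first by rewrite bary_of_comb.
    by rewrite -addrA addrC bary_of_comb// -xyz; ring.
  by rewrite addrC addrA bary_of_comb// -xyz; ring.
apply/hull3P; exists (bary a b c p), (bary b c a p), (bary c a b p).
by split => //; [exact: bary_sum | exact: bary_comb].
Qed.

Lemma hull3_interior_connected : connected (interior (hull [:: a; b; c])).
Proof.
apply: segment_closed_connected; apply: segment_closed_interior.
move=> p q /hull3_bary[p1 p2 p3] /hull3_bary[q1 q2 q3] s /andP[s0 s1].
have s1' : 0 <= 1 - s by rewrite subr_ge0.
by apply/hull3_bary; rewrite !bary_affine; split; rewrite addr_ge0// mulr_ge0.
Qed.

(** The complement is a union of three open half-planes, one beyond each side. The two explicit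
    points lie beyond two sides at once and so link the half-planes. *)
Lemma hull3_complement_connected : connected (~` hull [:: a; b; c]).
Proof.
have -> : ~` hull [:: a; b; c] = [set p | bary a b c p < 0] `|`
    [set p | bary b c a p < 0] `|` [set p | bary c a b p < 0].
  apply/seteqP; split=> p /=.
    move=> np; apply: contrapT => /not_orP[/not_orP[/negP p1 /negP p2] /negP p3].
    by apply: np; apply/hull3_bary; rewrite !leNgt.
  move=> H /hull3_bary[]; rewrite !leNgt => /negP p1 /negP p2 /negP p3.
  by case: H => [[]|].
have E1 (x y z : R) : x + y + z = 1 -> bary b c a (x *: a + y *: b + z *: c) = y.
  by move=> xyz; rewrite -addrA addrC bary_of_comb// -xyz; ring.
have E2 (x y z : R) : x + y + z = 1 -> bary c a b (x *: a + y *: b + z *: c) = z.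
  by move=> xyz; rewrite addrC addrA bary_of_comb// -xyz; ring.
apply: connectedU.
- exists ((-1) *: a + 3 *: b + (-1) *: c); split; last by rewrite /= E2; lra.
  by left; rewrite /= bary_of_comb//; lra.
- apply: connectedU; try exact: connected_bary_lt0.
  exists ((-1) *: a + (-1) *: b + 3 *: c); split; rewrite /= ?bary_of_comb ?E1//; lra.
- exact: connected_bary_lt0.
Qed.

Lemma hull3_bounded : bounded_set (hull [:: a; b; c]).
Proof.
exists (`|a| + `|b| + `|c|); split; first exact: num_real.
move=> M ltM p /hull3P[x [y [z [x0 y0 z0 xyz ->]]]]; apply/ltW/(le_lt_trans _ ltM).
have H (u : R) (v : R * R) : 0 <= u <= 1 -> `|u *: v| <= `|v|.
  by move=> /andP[u0 u1]; rewrite normrZ ger0_norm// ler_piMl.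
apply: (le_trans (ler_normD _ _)); apply: lerD; last by apply: H; lra.
by apply: (le_trans (ler_normD _ _)); apply: lerD; apply: H; lra.
Qed.

(** A point without negative coordinates but with a zero one lies on a side, hence in [E]. Off [E]
    the signs thus split the plane into two open sets, and a connected set that meets the open
    triangle stays in it. *)
Lemma inside_component (E C : set (R * R)) p :
  hull [:: a; b] `<=` E -> hull [:: b; c] `<=` E -> hull [:: c; a] `<=` E ->
  connected C -> C `<=` ~` E -> C p ->
  0 < bary a b c p -> 0 < bary b c a p -> 0 < bary c a b p ->
  bounded_set C.
Proof.
move=> abE bcE caE Cc CE Cp p1 p2 p3.
pose U := [set p | 0 < bary a b c p] `&` [set p | 0 < bary b c a p] `&` [set p | 0 < bary c a b p].
pose V := [set p | bary a b c p < 0] `|` [set p | bary b c a p < 0] `|` [set p | bary c a b p < 0].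
have oU : open U.
  apply: openI; [apply: openI|]; exact: open_bary_gt0.
have oV : open V.
  apply: openU; [apply: openU|]; exact: open_bary_lt0.
have UV q : U q -> V q -> False.
  by rewrite /U /V /= => -[[q1 q2] q3] [[]|]; rewrite ltNge ltW.
have sep : separated U V.
  split; rewrite -subset0 => q [].
    by move=> /[swap] Vq /(_ V (open_nbhs_nbhs (conj oV Vq)))[r [Ur Vr]]; exact: (UV r).
  by move=> Uq /(_ U (open_nbhs_nbhs (conj oU Uq)))[r [Vr Ur]]; exact: (UV r).
suff CU : C `<=` U.
  have [M [Mr HM]] := hull3_bounded.
  exists M; split=> // N MN q Cq; apply: (HM _ MN).
  have [[q1 q2] q3] := CU _ Cq.
  by apply/hull3_bary; split; exact: ltW.
have CUV : C `<=` U `|` V.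
  move=> q Cq; apply: contrapT => /not_orP[nU nV].
  have [q1 q2 q3] : [/\ 0 <= bary a b c q, 0 <= bary b c a q & 0 <= bary c a b q].
    move: nV => /not_orP[/not_orP[/negP ? /negP ?] /negP ?].
    by rewrite !leNgt.
  have qs := bary_sum abc q; have qE := bary_comb abc q.
  apply: (CE _ Cq); have [z1|z1] := eqVneq (bary a b c q) 0.
    apply: bcE; rewrite qE z1 scale0r add0r; apply: hull2 => //.
    by rewrite z1 add0r in qs.
  have [z2|z2] := eqVneq (bary b c a q) 0.
    apply: caE; rewrite qE z2 scale0r addr0 addrC; apply: hull2 => //.
    by rewrite z2 addr0 addrC in qs.
  have [z3|z3] := eqVneq (bary c a b q) 0.
    apply: abE; rewrite qE z3 scale0r addr0; apply: hull2 => //.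
    by rewrite z3 addr0 in qs.
  by case: nU; rewrite /U /= !lt0r z1 z2 z3 q1 q2 q3.
have [//|CV] := connected_subset sep CUV Cc.
by case: (UV p _ (CV _ Cp)).
Qed.

End TriangleDomain.

End Plane.

(** * Criteria for terrains and internal vertices *)

Section TerrainCriteria.
Variable R : realType.
Implicit Types (T : terrain R) (t : nat * nat * nat).

Lemma triangulation_is_terrain T t0 :
  nondegenerate (proj T) t0 ->
  triangulation (proj T) (hull (map (proj T) (corners t0))) (tris T) ->
  tris T != [::] ->
  (forall t, t \in tris T -> forall i, i \in corners t -> (i < size (verts T))%N) ->
  (forall i, (i < size (verts T))%N -> exists2 t, t \in tris T & i \in corners t) ->
  is_terrain T.
Proof.
move=> nt0 [nd pw DE] ne bnd cov.
have domE : domain T = hull (map (proj T) (corners t0)) by rewrite DE.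
split => //.
- by move=> t tT; split; [exact: bnd|exact: nd].
- move=> i j /andP[ij jT].
  have iT := ltn_trans ij jT.
  by have /(pairwiseP (0%N, 0%N, 0%N))/(_ i j iT jT ij)/asboolP := pw.
- by rewrite domE; split; [exact: hull3_interior_connected|
    exact: hull3_complement_connected].
Qed.

(** The open triangle is a neighbourhood of the vertex that misses the unbounded face, whatever else
    is drawn inside it. *)
Lemma internal_inside T i a b c (x y z : R) :
  neighbors T a b -> neighbors T b c -> neighbors T c a ->
  orient (proj T a) (proj T b) (proj T c) != 0 ->
  0 < x -> 0 < y -> 0 < z -> x + y + z = 1 ->
  proj T i = x *: proj T a + y *: proj T b + z *: proj T c ->
  internal T i.
Proof.
move=> ab bc ca abc x0 y0 z0 xyz iE.
set A := proj T a in abc iE *; set B := proj T b in abc iE *; set C := proj T c in abc iE *.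
have bca : orient B C A != 0 by rewrite -orientC.
have cab : orient C A B != 0 by rewrite orientC.
pose U := [set p | 0 < bary A B C p] `&` [set p | 0 < bary B C A p] `&` [set p | 0 < bary C A B p].
have oU : open U by apply: openI; [apply: openI|]; exact: open_bary_gt0.
have Ui : U (proj T i).
  rewrite iE; split; first (split; rewrite /=).
  - by rewrite bary_of_comb.
  - by rewrite -addrA addrC bary_of_comb// -xyz; ring.
  - by rewrite /= addrC addrA bary_of_comb// -xyz; ring.
have side u v : neighbors T u v -> hull [:: proj T u; proj T v] `<=` drawing T.
  by move=> uv p pf; exists u, v.
move=> /(_ U (open_nbhs_nbhs (conj oU Ui)))[p [unb [[p1 p2] p3]]].
apply: unb; have [pd|pd] := pselect ((~` drawing T) p).
  apply: (inside_component abc (side _ _ ab) (side _ _ bc) (side _ _ ca) _ _ _ p1 p2 p3).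
  - exact: component_connected.
  - exact: connected_component_sub.
  - exact: connected_component_refl.
(* A point of the drawing itself has the empty set as its component, which is bounded. *)
rewrite connected_component_out//.
by exists 0; split => [|M _ q]; first exact: real0.
Qed.

End TerrainCriteria.

(** * The terrain of a set of integers *)

Section Construction.
Variables (R : realType) (S : seq int).

Definition ngad : nat := (3 * size S)%N.
Local Notation N := ngad.

Definition elt (i : nat) : R := (nth 0 S i)%:~R.

(* Element i gives rise to the gadgets 3i, 3i+1 and 3i+2, one for each direction of lines. *)
Definition sigma (j : nat) : R :=
  if (j %% 3 < 2)%N then elt (j %/ 3) else - (elt (j %/ 3) / 2).

Definition xP (j : nat) : R := (j %% 3 == 1)%N%:R.
Definition zP (j : nat) : R := - \sum_(k < j) sigma k.
Definition ptP (j : nat) : point3 R := ((xP j, - j%:R), zP j).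

(** Exceeds every |z| in the set, because |z| <= z^2 for integers, and is computed by field
    operations alone. *)
Definition bigQ : R := 1 + \sum_(z <- S) z%:~R ^+ 2.
(** Makes the base so wide that each chain vertex lies strictly inside the triangle of [ptA], [ptB]
    and its predecessor. *)
Definition bigK : R := 2 * N%:R + 4.
(** On the box, the x and y coordinates contribute at most [bigQ * (3 * N + 5)] to a scalar product;
    this is twice that amount plus 10 [bigQ]. *)
Definition bigH : R := bigQ * (6 * N%:R + 20).
(** Scales level differences below 2 [bigH] to less than 1/32, half the lift in [peak]. *)
Definition eta : R := 1 / (64 * bigH).

(** The base line lies one unit beyond the last chain vertex, so the triangle in front of the chain
    never degenerates. *)
Definition ptA : point3 R := ((- bigK, - (N%:R + 1)), - bigH).
Definition ptB : point3 R := ((bigK, - (N%:R + 1)), - bigH).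

Definition above (u v w : point3 R) : point3 R :=
  (((u.1.1 + v.1.1 + w.1.1) / 3, (u.1.2 + v.1.2 + w.1.2) / 3), bigH).

Definition spike (j : nat) : point3 R :=
  if j == N then above ptA ptB (ptP j) else above ptB (ptP j) (ptP j.+1).

Definition peak (j : nat) : point3 R :=
  let mix a u v := (1 - eta) / 2 * (u + v) + eta * a in
  ((mix ptA.1.1 (ptP j).1.1 (ptP j.+1).1.1, mix ptA.1.2 (ptP j).1.2 (ptP j.+1).1.2),
   mix ptA.2 (ptP j).2 (ptP j.+1).2 + 1 / 16).

(* For j <= ngad, the indices of [ptP j], [spike j] and [peak j] are 3j+2, 3j+3 and 3j+4;
   there is no [peak ngad]. *)
Definition gvert (i : nat) : point3 R :=
  match i with
  | 0 => ptA
  | 1 => ptB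
  | m.+2 => if (m %% 3 == 0)%N then ptP (m %/ 3)
            else if (m %% 3 == 1)%N then spike (m %/ 3) else peak (m %/ 3)
  end.

(** The corner orders are those in which [split3] leaves them. *)
Definition tri6 (j : nat) : seq (nat * nat * nat) :=
  let: (p, s, v, p') := ((3 * j).+2, (3 * j).+3, (3 * j).+4, (3 * j).+1.+4) in
  [:: (s, 1, p); (p', s, p); (p', 1, s); (v, p', p); (0, v, p); (0, p', v)]%N.

Definition tri3 : seq (nat * nat * nat) :=
  [:: ((3 * N).+3, 1, (3 * N).+2); (0, (3 * N).+3, (3 * N).+2); (0, 1, (3 * N).+3)]%N.

Definition gterrain : terrain R :=
  Terrain (mkseq gvert (3 * N).+4) (flatten (mkseq tri6 N) ++ tri3).

Local Notation T := gterrain.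

Lemma gvertP j : gvert (3 * j).+2 = ptP j.
Proof. by rewrite /= modnMr eqxx mulKn. Qed.

Lemma gvert_spike j : gvert (3 * j).+3 = spike j.
Proof.
rewrite /= -addn1 mulnC.
have -> : ((j * 3 + 1) %% 3 = 1)%N by rewrite modnMDl.
by have -> : ((j * 3 + 1) %/ 3 = j)%N by rewrite divnMDl// addn0.
Qed.

Lemma gvert_peak j : gvert (3 * j).+4 = peak j.
Proof.
rewrite /= -addn2 mulnC.
have -> : ((j * 3 + 2) %% 3 = 2)%N by rewrite modnMDl.
by have -> : ((j * 3 + 2) %/ 3 = j)%N by rewrite divnMDl// addn0.
Qed.

Lemma vertexE i : (i < (3 * N).+4)%N -> vertex T i = gvert i.
Proof. by move=> iN; rewrite /vertex nth_mkseq. Qed.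

Lemma projE i : (i < (3 * N).+4)%N -> proj T i = (gvert i).1.
Proof. by move=> iN; rewrite /proj vertexE. Qed.

Lemma projP j : (j <= N)%N -> proj T (3 * j).+2 = (ptP j).1.
Proof. by move=> jN; rewrite projE ?gvertP//; lia. Qed.

Lemma projP' j : (j < N)%N -> proj T (3 * j).+1.+4 = (ptP j.+1).1.
Proof. by move=> jN; rewrite -projP//; congr (proj _ _); lia. Qed.

Lemma proj_spike j : (j <= N)%N -> proj T (3 * j).+3 = (spike j).1.
Proof. by move=> jN; rewrite projE ?gvert_spike//; lia. Qed.

Lemma proj_peak j : (j < N)%N -> proj T (3 * j).+4 = (peak j).1.
Proof. by move=> jN; rewrite projE ?gvert_peak//; lia. Qed.

Lemma projA : proj T 0 = ptA.1. Proof. by rewrite projE. Qed.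
Lemma projB : proj T 1 = ptB.1. Proof. by rewrite projE. Qed.

Lemma bigQ_ge1 : 1 <= bigQ.
Proof. by rewrite lerDl sumr_ge0// => z _; exact: sqr_ge0. Qed.

Lemma bigH_ge20 : 20 <= bigH.
Proof.
have := bigQ_ge1; rewrite /bigH; have : 0 <= N%:R :> R by [].
by move: bigQ N%:R => q k k0 q1; nra.
Qed.

Lemma eta_gt0 : 0 < eta.
Proof. by rewrite divr_gt0// mulr_gt0// (lt_le_trans _ bigH_ge20). Qed.

Lemma eta_lt : eta < 1 / 1000.
Proof.
rewrite /eta ltr_pdivrMr; first by have := bigH_ge20; lra.
by rewrite mulr_gt0// (lt_le_trans _ bigH_ge20).
Qed.

Lemma pair_eq (p q : R * R) : p.1 = q.1 -> p.2 = q.2 -> p = q.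
Proof. by case: p q => [? ?] [? ?] /= -> ->. Qed.

(* Barycentric coordinates of [ptP j.+1] in the triangle of [ptA], [ptB] and [ptP j]. *)
Definition wtP (j : nat) (i : nat) : R :=
  let u := 1 / (N%:R + 1 - j%:R) in
  let d := (xP j.+1 - (1 - u) * xP j) / bigK in
  match i with 0 => (u - d) / 2 | 1 => (u + d) / 2 | _ => 1 - u end.

Lemma xP_01 j : xP j = 0 \/ xP j = 1.
Proof. by rewrite /xP; case: eqP; [right|left]. Qed.

Lemma wtP_gt0 j i : (j < N)%N -> 0 < wtP j i.
Proof.
move=> jN; have jN' : j%:R + 1 <= N%:R :> R by rewrite natr1 ler_nat.
have j0 : 0 <= j%:R :> R by [].
have K0 : 0 < bigK by rewrite /bigK; lra.
have D0 : 0 < N%:R + 1 - j%:R :> R by lra.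
set u := 1 / (N%:R + 1 - j%:R) : R.
have u0 : 0 < u by rewrite divr_gt0.
have u1 : u < 1 by rewrite /u ltr_pdivrMr//; lra.
set d := (xP j.+1 - (1 - u) * xP j) / bigK.
(* The horizontal room at the height of the next chain vertex exceeds the shift in x, which is at
   most 1. *)
have uK : 1 < u * bigK by rewrite /u mul1r mulrC ltr_pdivlMr// /bigK; lra.
have [d1 d2] : d < u /\ - u < d.
  rewrite /d ltr_pdivrMr// ltr_pdivlMr//.
  by case: (xP_01 j) => ->; case: (xP_01 j.+1) => ->; split; lra.
rewrite /wtP -/u -/d; case: i => [|[|i]]; lra.
Qed.

Lemma wtP_sum j : wtP j 0 + wtP j 1 + wtP j 2 = 1.
Proof. by rewrite /wtP; set u := 1 / _; set d := _ / bigK; lra. Qed.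

Definition wtv (i : nat) : R := if i == 0%N then eta else (1 - eta) / 2.

Lemma wtv_gt0 i : 0 < wtv i.
Proof. by rewrite /wtv; have := eta_gt0; have := eta_lt; case: ifP => _; lra. Qed.

Lemma fst_big_comb (l : seq nat) (w : nat -> R) (f : nat -> R * R) :
  \sum_(x <- l) w x *: f x = (\sum_(x <- l) w x * (f x).1, \sum_(x <- l) w x * (f x).2).
Proof.
by elim: l => [|x l IH]; rewrite ?big_nil ?big_cons // IH.
Qed.

Lemma comb_P' j : (j < N)%N -> proj T (3 * j).+1.+4 =
  \sum_(x <- corners (0, 1, (3 * j).+2)%N) wtP j x *: proj T x.
Proof.
move=> jN; have jN' : j%:R + 1 <= N%:R :> R by rewrite natr1 ler_nat.
have j0 : 0 <= j%:R :> R by [].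
have K0 : bigK != 0 by apply: lt0r_neq0; rewrite /bigK; lra.
have D0 : N%:R + 1 - j%:R != 0 :> R by apply: lt0r_neq0; lra.
rewrite fst_big_comb /corners /= !big_cons !big_nil projA projB projP' // projP ?(ltnW jN)//.
apply: pair_eq; rewrite /= /wtP.
  by move: (xP j) (xP j.+1) => x x'; field; rewrite K0 D0.
by rewrite -[j.+1%:R]natr1; move: (xP j) (xP j.+1) => x x'; field; rewrite K0 D0.
Qed.

Lemma comb_spike j : (j < N)%N -> proj T (3 * j).+3 =
  \sum_(x <- corners ((3 * j).+1.+4, 1, (3 * j).+2)%N) (1 / 3) *: proj T x.
Proof.
move=> jN; rewrite (fst_big_comb _ (fun=> 1 / 3)) /corners /= !big_cons !big_nil projB
  projP' // projP ?(ltnW jN)// proj_spike ?(ltnW jN)// /spike (ltn_eqF jN).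
by apply: pair_eq; rewrite /=; field.
Qed.

Lemma comb_last_spike : proj T (3 * N).+3 =
  \sum_(x <- corners (0, 1, (3 * N).+2)%N) (1 / 3) *: proj T x.
Proof.
rewrite (fst_big_comb _ (fun=> 1 / 3)) /corners /= !big_cons !big_nil projB projA
  projP // proj_spike // /spike eqxx.
by apply: pair_eq; rewrite /=; field.
Qed.

Lemma comb_peak j : (j < N)%N -> proj T (3 * j).+4 =
  \sum_(x <- corners (0, (3 * j).+1.+4, (3 * j).+2)%N) wtv x *: proj T x.
Proof.
move=> jN; rewrite fst_big_comb /corners /= !big_cons !big_nil projA
  projP' // projP ?(ltnW jN)// proj_peak // /wtv/=.
by apply: pair_eq; rewrite /=; move: eta => e; field.
Qed.

Lemma split3E a b c v : uniq [:: a; b; c] ->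
  split3 (a, b, c) v = [:: (v, b, c); (a, v, c); (a, b, v)].
Proof.
rewrite /= !inE => /and3P[/norP[/negbTE ab /negbTE ac] /negbTE bc _].
by rewrite /split3 /repl /= !eqxx ab ac bc [b == a]eq_sym ab [c == a]eq_sym ac
  [c == b]eq_sym bc.
Qed.

Lemma sum_corners a b c (w : nat -> R) :
  \sum_(x <- corners (a, b, c)) w x = w a + w b + w c.
Proof. by rewrite /corners /= !big_cons big_nil addr0 addrA. Qed.

Lemma third_gt0 : 0 < 1 / 3 :> R. Proof. lra. Qed.

Lemma third_sum : 1 / 3 + 1 / 3 + 1 / 3 = 1 :> R. Proof. lra. Qed.

Lemma wtv_sum j k : wtv 0 + wtv j.+1 + wtv k.+1 = 1.
Proof. by rewrite /wtv /=; lra. Qed.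

(** The triangle still to be subdivided, followed by the finished gadgets. *)
Definition stage (j : nat) := (0, 1, (3 * j).+2)%N :: flatten (mkseq tri6 j).

(** Makes the indices of the next three vertices fresh for insertion. *)
Lemma stage_lt j t i : t \in stage j -> i \in corners t -> (i < (3 * j).+3)%N.
Proof.
rewrite in_cons => /orP[/eqP -> /=|].
  by rewrite !inE /= => /or3P[] /eqP ->; lia.
move=> /flattenP[l /mapP[k]]; rewrite mem_iota add0n => /andP[_ kj] ->.
by rewrite !inE => /or4P[|||/or3P[]] /eqP -> /= /or3P[] /eqP ->; lia.
Qed.

Lemma flatten_tri6S j : flatten (mkseq tri6 j.+1) = flatten (mkseq tri6 j) ++ tri6 j.
Proof. by rewrite mkseqS flatten_rcons. Qed.

(** A gadget is three insertions: the next chain vertex into the front triangle, then a spike into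
    the piece at B and a peak into the piece at A. The third piece, which contains both A and B, is
    the next front triangle. *)
Lemma triangulation_stage j : (j <= N)%N ->
  triangulation (proj T) (hull (map (proj T) (corners (0, 1, 2)%N))) (stage j).
Proof.
elim: j => [_|j IH jN].
  split => //=.
    move=> t; rewrite inE => /eqP -> /=.
    rewrite /nondegenerate /= projA projB (projP (leq0n _)) /orient /= /xP /=.
    have -> : (bigK - - bigK) * (- 0 - - (N%:R + 1)) -
      (- (N%:R + 1) - - (N%:R + 1)) * (0 - - bigK) = 2 * bigK * (N%:R + 1) :> R by ring.
    have N0 : 0 <= N%:R :> R by [].
    by rewrite /bigK !mulf_neq0//; apply: lt0r_neq0; lra.
  by apply/seteqP; split=> p /=; [exists (0, 1, 2)%N => //; rewrite mem_head|
    move=> [t]; rewrite inE => /eqP ->].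
have jN' := ltnW jN.
have fresh k t : (3 * j < k)%N -> t \in stage j -> k.+2 \notin corners t.
  by move=> jk tj; apply/negP => /(stage_lt tj); lia.
have fP' t : t \in stage j -> (3 * j).+1.+4 \notin corners t by apply: fresh; lia.
have := triangulation_insert (IH jN') fP' (fun x _ => wtP_gt0 x jN).
rewrite sum_corners wtP_sum split3E//.
move=> /(_ erefl (comb_P' jN)) /= H1.
have fS t : t \in [:: ((3 * j).+1.+4, 1, (3 * j).+2), (0, (3 * j).+1.+4, (3 * j).+2),
    (0, 1, (3 * j).+1.+4) & flatten (mkseq tri6 j)]%N ->
    (3 * j).+3 \notin corners t /\ (3 * j).+4 \notin corners t.
  rewrite !in_cons => /or4P[/eqP ->|/eqP ->|/eqP ->|tj]; try by rewrite !inE /=; lia.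
  by split; apply: fresh; rewrite ?in_cons ?tj ?orbT; lia.
have := triangulation_insert H1 (fun t tj => (fS t tj).1) (fun x _ => third_gt0).
rewrite sum_corners split3E; last by rewrite /= !inE; lia.
move=> /(_ third_sum (comb_spike jN)) /= H2.
(* Insertion splits the head of the list, so the piece at A is moved there. *)
have /triangulation_perm/(_ H2) H3 : perm_eq
   [:: ((3 * j).+3, 1, (3 * j).+2), ((3 * j).+1.+4, (3 * j).+3, (3 * j).+2),
      ((3 * j).+1.+4, 1, (3 * j).+3), (0, (3 * j).+1.+4, (3 * j).+2),
      (0, 1, (3 * j).+1.+4) & flatten (mkseq tri6 j)]%N
   [:: (0, (3 * j).+1.+4, (3 * j).+2), ((3 * j).+3, 1, (3 * j).+2),
      ((3 * j).+1.+4, (3 * j).+3, (3 * j).+2), ((3 * j).+1.+4, 1, (3 * j).+3),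
      (0, 1, (3 * j).+1.+4) & flatten (mkseq tri6 j)]%N.
  by apply/permP => a /=; lia.
have := triangulation_insert (v := (3 * j).+4) H3 _ (fun x _ => wtv_gt0 x).
rewrite sum_corners split3E; last by rewrite /= !inE; lia.
move=> /(_ _ (wtv_sum _ _) (comb_peak jN)) /= H4.
apply: triangulation_perm (H4 _).
  apply/permP => a; rewrite /stage flatten_tri6S /= count_cat /=.
  have -> : (3 * j.+1).+2 = (3 * j).+1.+4 by lia.
  lia.
move=> t; rewrite !in_cons => /or4P[/eqP ->|/eqP ->|/eqP ->|]; try by rewrite !inE /=; lia.
move=> /or3P[/eqP ->|/eqP ->|tj]; try by rewrite !inE /=; lia.
by apply: fresh; rewrite ?in_cons ?tj ?orbT; lia.
Qed.

Lemma nondegenerate_stage j : (j <= N)%N -> nondegenerate (proj T) (0, 1, (3 * j).+2)%N.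
Proof. by move=> /triangulation_stage[+ _ _]; apply; rewrite mem_head. Qed.

Lemma nondegenerate_B j : (j < N)%N ->
  nondegenerate (proj T) ((3 * j).+1.+4, 1, (3 * j).+2)%N.
Proof.
move=> jN; have nt := nondegenerate_stage (ltnW jN).
have : nondegenerate (proj T) (repl (0, 1, (3 * j).+2)%N 0 (3 * j).+1.+4).
  apply: (nondegenerate_repl (lam := wtP j)) => //.
  - by move=> x _; exact: wtP_gt0.
  - by rewrite sum_corners wtP_sum.
  - exact: comb_P'.
by [].
Qed.

Lemma nondegenerate_A j : (j < N)%N ->
  nondegenerate (proj T) (0, (3 * j).+1.+4, (3 * j).+2)%N.
Proof.
move=> jN; have nt := nondegenerate_stage (ltnW jN).
have : nondegenerate (proj T) (repl (0, 1, (3 * j).+2)%N 1 (3 * j).+1.+4).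
  apply: (nondegenerate_repl (lam := wtP j)) => //.
  - by move=> x _; exact: wtP_gt0.
  - by rewrite sum_corners wtP_sum.
  - exact: comb_P'.
by [].
Qed.

Lemma triangulation_tris :
  triangulation (proj T) (hull (map (proj T) (corners (0, 1, 2)%N))) (tris T).
Proof.
have fresh t : t \in stage N -> (3 * N).+3 \notin corners t.
  by move=> tj; apply/negP => /(stage_lt tj); lia.
have := triangulation_insert (triangulation_stage (leqnn N)) fresh (fun x _ => third_gt0).
rewrite sum_corners split3E//.
move=> /(_ third_sum comb_last_spike) H; apply: triangulation_perm H.
by apply/permP => a; rewrite /tris !count_cat addnC.
Qed.

End Construction.

(** * Validity of the terrain and its adjacency relation *)

Section LocalMaxima.
Variables (R : realType) (S : seq int).

Local Notation N := (ngad S).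
Local Notation T := (gterrain R S).

Lemma mem_tri6 j t : (j < N)%N -> t \in tri6 j -> t \in tris T.
Proof.
move=> jN tj; rewrite mem_cat; apply/orP; left; apply/flattenP.
by exists (tri6 j) => //; apply: map_f; rewrite mem_iota.
Qed.

Lemma mem_tri3 t : t \in tri3 S -> t \in tris T.
Proof. by move=> tj; rewrite mem_cat tj orbT. Qed.

Lemma tris_inv t : t \in tris T -> (exists2 k, (k < N)%N & t \in tri6 k) \/ t \in tri3 S.
Proof.
rewrite mem_cat => /orP[/flattenP[l /mapP[k]]|]; last by right.
by rewrite mem_iota add0n => /andP[_ kN] -> tk; left; exists k.
Qed.

Lemma size_verts : size (verts T) = (3 * N).+4.
Proof. by rewrite size_mkseq. Qed.

Lemma gterrain_is_terrain : is_terrain T.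
Proof.
apply: (triangulation_is_terrain (t0 := (0, 1, 2)%N)).
- by have := @nondegenerate_stage R S 0 (leq0n N); rewrite muln0.
- exact: triangulation_tris.
- by rewrite -size_eq0 size_cat addnS.
- move=> t tT i it; rewrite size_verts.
  move: tT it => /tris_inv[[k kN]|].
    by rewrite !inE => /or4P[|||/or3P[]] /eqP -> /= /or3P[] /eqP ->; lia.
  by rewrite !inE => /or3P[] /eqP -> /= /or3P[] /eqP ->; lia.
- move=> i; rewrite size_verts => iN.
  have [i2|i2] := leqP i 1.
    exists (0, 1, (3 * N).+3)%N; first by rewrite mem_tri3// !inE eqxx !orbT.
    by rewrite !inE /=; lia.
  have [j [ji jN]] : exists j, ((3 * j).+2 <= i < (3 * j).+1.+4)%N /\ (j <= N)%N.
    exists ((i - 2) %/ 3)%N; split; last lia.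
    by have := divn_eq (i - 2) 3; have := ltn_pmod (i - 2) (isT : 0 < 3)%N; lia.
  have [jlt|jge] := ltnP j N.
    have [->|->|->] : [\/ i = (3 * j).+2, i = (3 * j).+3 | i = (3 * j).+4].
    + have [|h] := eqVneq i (3 * j).+2; first by constructor 1.
      have [|h'] := eqVneq i (3 * j).+3; first by constructor 2.
      by constructor 3; lia.
    + by exists ((3 * j).+3, 1, (3 * j).+2)%N;
        [rewrite (mem_tri6 jlt)// !inE eqxx | rewrite !inE /=; lia].
    + by exists ((3 * j).+3, 1, (3 * j).+2)%N;
        [rewrite (mem_tri6 jlt)// !inE eqxx | rewrite !inE /=; lia].
    + by exists (0, (3 * j).+4, (3 * j).+2)%N;
        [rewrite (mem_tri6 jlt)// !inE eqxx ?orbT | rewrite !inE /=; lia].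
  have jE : j = N by lia.
  exists ((3 * N).+3, 1, (3 * N).+2)%N; first by rewrite mem_tri3// !inE eqxx.
  by rewrite !inE /=; lia.
Qed.

Lemma neighborsI t i j : t \in tris T -> i \in corners t -> j \in corners t ->
  i != j -> neighbors T i j.
Proof. by move=> tT it jt ij; rewrite /neighbors ij; apply/hasP; exists t; rewrite ?it. Qed.

Lemma neighborsC i j : neighbors T i j = neighbors T j i.
Proof. by rewrite /neighbors eq_sym; congr (_ && _); apply: eq_has => t; rewrite andbC. Qed.

Lemma neighborsE i j : neighbors T i j -> exists t, [/\ t \in tris T, i \in corners t,
  j \in corners t & i != j].
Proof. by move=> /andP[ij /hasP[t tT /andP[it jt]]]; exists t. Qed.

Lemma neighbors_spike j i : (j < N)%N -> neighbors T (3 * j).+3 i ->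
  i \in [:: 1; (3 * j).+2; (3 * j).+1.+4]%N.
Proof.
move=> jN /neighborsE[t [/tris_inv[[k kN]|]]]; rewrite !inE.
  by move=> /or4P[|||/or3P[]] /eqP -> /=; lia.
by move=> /or3P[] /eqP -> /=; lia.
Qed.

Lemma neighbors_peak j i : (j < N)%N -> neighbors T (3 * j).+4 i ->
  i \in [:: 0; (3 * j).+2; (3 * j).+1.+4]%N.
Proof.
move=> jN /neighborsE[t [/tris_inv[[k kN]|]]]; rewrite !inE.
  by move=> /or4P[|||/or3P[]] /eqP -> /=; lia.
by move=> /or3P[] /eqP -> /=; lia.
Qed.

Lemma neighbors_last_spike i : neighbors T (3 * N).+3 i ->
  i \in [:: 0; 1; (3 * N).+2]%N.
Proof.
move=> /neighborsE[t [/tris_inv[[k kN]|]]]; rewrite !inE.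
  by move=> /or4P[|||/or3P[]] /eqP -> /=; lia.
by move=> /or3P[] /eqP -> /=; lia.
Qed.

Lemma neighbors_spikeP j : (j <= N)%N -> neighbors T (3 * j).+2 (3 * j).+3.
Proof.
rewrite leq_eqVlt => /orP[/eqP ->|jN].
  by apply: (neighborsI (t := ((3 * N).+3, 1, (3 * N).+2)%N));
    [rewrite mem_tri3// !inE eqxx | rewrite ?inE /=; lia ..].
by apply: (neighborsI (t := ((3 * j).+3, 1, (3 * j).+2)%N));
  [rewrite (mem_tri6 jN)// !inE eqxx | rewrite ?inE /=; lia ..].
Qed.

Lemma neighbors_last (i j : nat) : i \in [:: 0; 1; (3 * N).+2; (3 * N).+3]%N ->
  j \in [:: 0; 1; (3 * N).+2; (3 * N).+3]%N -> i != j -> neighbors T i j.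
Proof.
move=> i4 j4 ij.
have H t : t \in tri3 S -> i \in corners t -> j \in corners t -> neighbors T i j.
  by move=> /mem_tri3 tT it jt; exact: neighborsI tT it jt ij.
have /H : ((3 * N).+3, 1, (3 * N).+2)%N \in tri3 S by rewrite !inE eqxx.
have /H : (0, (3 * N).+3, (3 * N).+2)%N \in tri3 S by rewrite !inE eqxx ?orbT.
have /H : (0, 1, (3 * N).+3)%N \in tri3 S by rewrite !inE eqxx ?orbT.
move: i4 j4 ij; rewrite !inE /= => i4 j4 ij m3 m2 m1.
by case: (boolP (neighbors T i j)) m3 m2 m1 => // _; lia.
Qed.

End LocalMaxima.

(** * Local maxima *)

Section Directions.
Variables (R : realType) (S : seq int).

Local Notation N := (ngad S).
Local Notation T := (gterrain R S).
Implicit Types (w : point3 R).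

Lemma vertexA : vertex T 0 = ptA R S. Proof. by rewrite vertexE. Qed.
Lemma vertexB : vertex T 1 = ptB R S. Proof. by rewrite vertexE. Qed.

Lemma vertexP j : (j <= N)%N -> vertex T (3 * j).+2 = ptP R S j.
Proof. by move=> jN; rewrite vertexE ?gvertP//; lia. Qed.

Lemma vertexP' j : (j < N)%N -> vertex T (3 * j).+1.+4 = ptP R S j.+1.
Proof. by move=> jN; rewrite -vertexP//; congr (vertex _ _); lia. Qed.

Lemma vertex_spike j : (j <= N)%N -> vertex T (3 * j).+3 = spike R S j.
Proof. by move=> jN; rewrite vertexE ?gvert_spike//; lia. Qed.

Lemma vertex_peak j : (j < N)%N -> vertex T (3 * j).+4 = peak R S j.
Proof. by move=> jN; rewrite vertexE ?gvert_peak//; lia. Qed.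

Lemma zPS j : zP R S j.+1 = zP R S j - sigma R S j.
Proof. by rewrite /zP big_ord_recr /= opprD. Qed.

Lemma local_max_lt w i j : (i < (3 * N).+4)%N -> (j < (3 * N).+4)%N ->
  local_max T w i -> neighbors T i j -> dot3 (gvert R S j) w < dot3 (gvert R S i) w.
Proof. by move=> iN jN lm /lm; rewrite !vertexE. Qed.

Lemma neighbors_peakI j : (j < N)%N -> [/\ neighbors T (3 * j).+4 0,
  neighbors T (3 * j).+4 (3 * j).+2 & neighbors T (3 * j).+4 (3 * j).+1.+4].
Proof.
move=> jN; split.
- by apply: (neighborsI (t := (0, (3 * j).+4, (3 * j).+2)%N));
    [rewrite (mem_tri6 _ jN)// !inE eqxx ?orbT | rewrite ?inE /=; lia ..].
- by apply: (neighborsI (t := (0, (3 * j).+4, (3 * j).+2)%N));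
    [rewrite (mem_tri6 _ jN)// !inE eqxx ?orbT | rewrite ?inE /=; lia ..].
- by apply: (neighborsI (t := ((3 * j).+4, (3 * j).+1.+4, (3 * j).+2)%N));
    [rewrite (mem_tri6 _ jN)// !inE eqxx ?orbT | rewrite ?inE /=; lia ..].
Qed.

Lemma gvertP' j : gvert R S (3 * j).+1.+4 = ptP R S j.+1.
Proof. by rewrite -gvertP; congr gvert; lia. Qed.

Lemma dot_peak j w : dot3 (peak R S j) w =
  (1 - eta R S) / 2 * (dot3 (ptP R S j) w + dot3 (ptP R S j.+1) w) +
  eta R S * dot3 (ptA R S) w + w.2 / 16.
Proof. by rewrite /dot3 /peak /=; field. Qed.

Lemma dot_ptPS j w : dot3 (ptP R S j.+1) w = dot3 (ptP R S j) w +
  (w.1.1 * (xP R j.+1 - xP R j) - w.1.2 - w.2 * sigma R S j).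
Proof. by rewrite /dot3 /ptP /= zPS -natr1; ring. Qed.

(** The peak is 1/16 above a convex combination of its neighbours, so being a maximum needs
    [0 < w.2]. Being higher than A limits the gain from the pull towards A to w.2 / 16. The excess
    over the midpoint of the edge is then below w.2 / 8, and it must exceed half the level
    difference of the ends. *)
Lemma peak_strip w j : (j < N)%N -> local_max T w (3 * j).+4 ->
  0 < w.2 /\
  `|w.1.1 * (xP R j.+1 - xP R j) - w.1.2 - w.2 * sigma R S j| < w.2 / 4.
Proof.
move=> jN lm; have [nA nP nP'] := neighbors_peakI jN.
have vlt : ((3 * j).+4 < (3 * N).+4)%N by lia.
have := local_max_lt vlt _ lm nA; have := local_max_lt vlt _ lm nP.
have := local_max_lt vlt _ lm nP'.
rewrite gvertP' gvertP gvert_peak dot_peak dot_ptPS.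
set D := _ - w.2 * _.
move=> /(_ ltac:(lia)) h1 /(_ ltac:(lia)) h2 /(_ ltac:(lia)) h3.
move: h1 h2 h3; have := eta_gt0 R S; have := eta_lt R S.
change (dot3 (gvert R S 0) w) with (dot3 (ptA R S) w).
move: (dot3 (ptA R S) w) (dot3 (ptP R S j) w) (eta R S) => fA fP e.
have -> : (1 - e) / 2 * (fP + (fP + D)) + e * fA + w.2 / 16 =
  fP + D / 2 + e * (fA - (fP + D / 2)) + w.2 / 16 by field.
set m := fP + D / 2.
have -> : fP = m - D / 2 by rewrite /m; ring.
have -> : m - D / 2 + D = m + D / 2 by field.
move: m => m e1 e0 h1 h2 h3.
have w0 : 0 < w.2.
  (* The average of the neighbour inequalities with weights 1 - e and e; everything but the lift
     cancels. *)
  have a1 : 0 < (1 - e) * (e * (fA - m) + w.2 / 16) by apply: mulr_gt0; lra.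
  have a2 : 0 < e * (m + e * (fA - m) + w.2 / 16 - fA) by apply: mulr_gt0; lra.
  by have : 0 < w.2 / 16; [apply: lt_le_trans (addr_gt0 a1 a2) _; rewrite le_eqVlt;
    apply/orP; left; apply/eqP; field|lra].
split => //.
have b : e * (fA - m) < w.2 / 16.
  have [le0|gt0] := lerP (fA - m) 0.
    by apply: (@le_lt_trans _ _ 0); [apply: mulr_ge0_le0; lra|lra].
  apply: (@le_lt_trans _ _ ((1 - e) * (fA - m))); first by apply: ler_wpM2r; lra.
  by rewrite mulrBl mul1r; lra.
by rewrite ltr_norml; apply/andP; split; lra.
Qed.

Lemma norm_int_le_sqr (z : int) : `|z%:~R : R| <= z%:~R ^+ 2.
Proof.
have -> : z%:~R ^+ 2 = (z * z)%:~R :> R by rewrite intrM expr2.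
by rewrite -intr_norm ler_int; nia.
Qed.

(** The three gadgets of an integer z contribute |z| + |z| + |z| / 2, at most 3 z^2 by
    integrality. *)
Lemma norm_sigma_sum m : \sum_(k < 3 * m) `|sigma R S k| <=
  3 * \sum_(i < m) elt R S i ^+ 2.
Proof.
elim: m => [|m IH]; first by rewrite muln0 !big_ord0 mulr0.
have -> : (3 * m.+1 = (3 * m).+3)%N by lia.
rewrite !big_ord_recr /= mulrDr -!addrA lerD//.
have E r : (r < 3)%N -> ((3 * m + r) %/ 3 = m /\ (3 * m + r) %% 3 = r)%N.
  by move=> r3; rewrite mulnC divnMDl// modnMDl divn_small// modn_small// addn0.
have [d0 m0] := E 0%N isT; have [d1 m1] := E 1%N isT; have [d2 m2] := E 2%N isT.
rewrite addn0 in d0 m0; rewrite addn1 in d1 m1; rewrite addn2 in d2 m2.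
have s := norm_int_le_sqr (nth 0 S m).
rewrite /sigma d0 d1 d2 m0 m1 m2 /= normrN normf_div (@ger0_norm _ 2)//.
rewrite -/(elt R S m) in s *.
have := normr_ge0 (elt R S m); lra.
Qed.

Lemma zP_bound j : (j <= N)%N -> `|zP R S j| <= 3 * (bigQ R S - 1).
Proof.
move=> jN; rewrite /zP normrN.
apply: (le_trans (ler_norm_sum _ _ _)).
apply: (@le_trans _ _ (\sum_(k < N) `|sigma R S k|)).
  rewrite -!(big_mkord xpredT (fun k => `|sigma R S k|)).
  by rewrite [leRHS](big_cat_nat (leq0n j) jN)//= lerDl sumr_ge0.
apply: (le_trans (norm_sigma_sum _)).
rewrite /bigQ addrC addKr ler_pM2l// (big_nth 0) big_mkord.
by [].
Qed.

(** * Scalar products for directions (p, q, 1) in the box of size [bigQ] *)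

Section Box.
Variables (p q : R).
Hypotheses (pQ : `|p| <= bigQ R S) (qQ : `|q| <= bigQ R S).
Let w : point3 R := ((p, q), 1).

Let Q0 : 0 <= bigQ R S. Proof. by have := bigQ_ge1 R S; lra. Qed.

Lemma dot_box (x y z cx cy : R) : `|x| <= cx -> `|y| <= cy ->
  `|dot3 ((x, y), z) w - z| <= bigQ R S * (cx + cy).
Proof.
move=> xc yc; rewrite /dot3 /= mulr1 addrK mulrDr.
apply: (le_trans (ler_normD _ _)); rewrite !normrM.
by rewrite lerD// mulrC ler_pM.
Qed.

Lemma xP_le1 j : `|xP R j| <= 1.
Proof. by case: (xP_01 R j) => ->; rewrite ?normr0 ?normr1. Qed.

Lemma dotP_box j : (j <= N)%N -> `|dot3 (ptP R S j) w| <= bigQ R S * (N%:R + 4).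
Proof.
move=> jN; have z3 := zP_bound jN.
have jN' : `|- j%:R : R| <= N%:R by rewrite normrN ger0_norm// ler_nat.
have := dot_box (zP R S j) (xP_le1 j) jN'.
rewrite -/(ptP R S j) => h.
rewrite -(subrK (zP R S j) (dot3 _ _)).
apply: (le_trans (ler_normD _ _)).
apply: (le_trans (lerD h z3)).
by lra.
Qed.

Lemma bigK_gt0 : 0 < bigK R S.
Proof. by rewrite /bigK; have : 0 <= N%:R :> R by []; lra. Qed.

Lemma dotA_box : `|dot3 (ptA R S) w + bigH R S| <= bigQ R S * (3 * N%:R + 5).
Proof.
have N0 : 0 <= N%:R :> R by [].
have hK : `|- bigK R S| <= bigK R S by rewrite ?normrN ger0_norm// ltW// bigK_gt0.
have hN : `|- (N%:R + 1) : R| <= N%:R + 1 by rewrite normrN ger0_norm//; lra.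
have := dot_box (- bigH R S) hK hN; rewrite opprK -/(ptA R S) => /le_trans; apply.
by rewrite ler_wpM2l// /bigK; lra.
Qed.

Lemma dotB_box : `|dot3 (ptB R S) w + bigH R S| <= bigQ R S * (3 * N%:R + 5).
Proof.
have N0 : 0 <= N%:R :> R by [].
have hK : `|bigK R S| <= bigK R S by rewrite ?normrN ger0_norm// ltW// bigK_gt0.
have hN : `|- (N%:R + 1) : R| <= N%:R + 1 by rewrite normrN ger0_norm//; lra.
have := dot_box (- bigH R S) hK hN; rewrite opprK -/(ptB R S) => /le_trans; apply.
by rewrite ler_wpM2l// /bigK; lra.
Qed.

Lemma spike_box j : (j <= N)%N ->
  `|dot3 (spike R S j) w - bigH R S| <= bigQ R S * (3 * N%:R + 5).
Proof.
move=> jN; have N0 : 0 <= N%:R :> R by [].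
have K0 := bigK_gt0; have KE : bigK R S = 2 * N%:R + 4 by [].
have P1 k : 0 <= xP R k /\ xP R k <= 1 by case: (xP_01 R k) => ->; rewrite lexx ler01.
have [j0 jN'] : (0 <= j%:R :> R) /\ (j%:R <= N%:R :> R) by rewrite ler_nat.
rewrite /spike; case: eqVneq => [jE|jne].
  rewrite /above; apply: (le_trans (dot_box _ (cx := bigK R S) (cy := N%:R + 1) _ _)).
  - by rewrite ler_norml /=; apply/andP; split; have := P1 j; lra.
  - by rewrite ler_norml /=; apply/andP; split; lra.
  - by rewrite ler_wpM2l// KE; lra.
have [j1 j1N] : (0 <= j.+1%:R :> R) /\ (j.+1%:R <= N%:R :> R) by rewrite ler_nat ler0n; split=> //; lia.
rewrite /above; apply: (le_trans (dot_box _ (cx := bigK R S) (cy := N%:R + 1) _ _)).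
- by rewrite ler_norml /=; apply/andP; split; have := P1 j; have := P1 j.+1; lra.
- by rewrite ler_norml /=; apply/andP; split; lra.
- by rewrite ler_wpM2l// KE; lra.
Qed.

(** Expresses the height through the very products that occur in the box bounds, so that linear
    arithmetic can treat these products as atoms. *)
Lemma HE : bigH R S = bigQ R S * (3 * N%:R + 5) + bigQ R S * (3 * N%:R + 5) + 10 * bigQ R S.
Proof. by rewrite /bigH; ring. Qed.

Lemma QE : bigQ R S * (3 * N%:R + 5) = bigQ R S * (N%:R + 4) + bigQ R S * (2 * N%:R + 1).
Proof. by ring. Qed.

Lemma spike_max j i : (j <= N)%N -> neighbors T (3 * j).+3 i ->
  dot3 (vertex T i) w < dot3 (vertex T (3 * j).+3) w.
Proof.
move=> jN nji; have Q1 := bigQ_ge1 R S.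
have QN : 0 <= bigQ R S * (2 * N%:R + 1) by rewrite mulr_ge0// addr_ge0// mulr_ge0.
have E1 := HE; have E2 := QE.
have /ler_normlP[s1 s2] := spike_box jN.
have /ler_normlP[a1 a2] := dotA_box; have /ler_normlP[b1 b2] := dotB_box.
have -> : vertex T (3 * j).+3 = spike R S j by exact: vertex_spike.
have hP k : (k <= N)%N -> dot3 (ptP R S k) w < dot3 (spike R S j) w.
  by move=> /dotP_box/ler_normlP[p1 p2]; lra.
have hA : dot3 (ptA R S) w < dot3 (spike R S j) w by lra.
have hB : dot3 (ptB R S) w < dot3 (spike R S j) w by lra.
move: nji; case: (eqVneq j N) => [E|jne].
  rewrite [in X in neighbors _ X _]E => /neighbors_last_spike; rewrite !inE => /or3P[] /eqP ->.
  - by rewrite vertexA; exact: hA.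
  - by rewrite vertexB; exact: hB.
  - by rewrite (vertexP (leqnn N)); apply: hP.
have jN' : (j < N)%N by rewrite ltn_neqAle jne.
move=> /(neighbors_spike jN'); rewrite !inE => /or3P[] /eqP ->.
- by rewrite vertexB; exact: hB.
- by rewrite (vertexP jN); apply: hP.
- by rewrite (vertexP' jN'); apply: hP.
Qed.

Lemma peak_max j i : (j < N)%N ->
  p * (xP R j.+1 - xP R j) - q = sigma R S j -> neighbors T (3 * j).+4 i ->
  dot3 (vertex T i) w < dot3 (vertex T (3 * j).+4) w.
Proof.
move=> jN strip nji; have Q1 := bigQ_ge1 R S.
have QN : 0 <= bigQ R S * (2 * N%:R + 1) by rewrite mulr_ge0// addr_ge0// mulr_ge0.
have E1 := HE; have E2 := QE.
have /ler_normlP[a1 a2] := dotA_box.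
have /ler_normlP[p1 p2] := dotP_box (ltnW jN).
have PE : dot3 (ptP R S j.+1) w = dot3 (ptP R S j) w.
  by rewrite dot_ptPS /= mul1r strip subrr addr0.
have Hg := bigH_ge20 R S.
have eH : eta R S * (64 * bigH R S) = 1 by rewrite /eta divfK// mulf_neq0//; apply: lt0r_neq0; lra.
have e0 := eta_gt0 R S; have e1 := eta_lt R S.
have d0 : 0 < dot3 (ptP R S j) w - dot3 (ptA R S) w by lra.
have d1 : dot3 (ptP R S j) w - dot3 (ptA R S) w < 2 * bigH R S by lra.
(* The pull towards A costs less than [eta * (2 * bigH)], which is 1/32. *)
have d2 : eta R S * (dot3 (ptP R S j) w - dot3 (ptA R S) w) < 1 / 16.
  by rewrite (@lt_trans _ _ (eta R S * (2 * bigH R S)))// ?ltr_pM2l//; lra.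
have fv : dot3 (peak R S j) w = dot3 (ptP R S j) w -
    eta R S * (dot3 (ptP R S j) w - dot3 (ptA R S) w) + 1 / 16.
  by rewrite dot_peak PE /=; field.
have -> : vertex T (3 * j).+4 = peak R S j by exact: vertex_peak.
have hP : dot3 (ptP R S j) w < dot3 (peak R S j) w by lra.
move: nji => /(neighbors_peak jN); rewrite !inE => /or3P[] /eqP ->.
- by rewrite vertexA; apply: lt_trans hP; lra.
- by rewrite (vertexP (ltnW jN)); exact: hP.
- by rewrite (vertexP' jN) PE; exact: hP.
Qed.

End Box.

End Directions.

(** * Classes of vertices with at most one local maximum each *)

Section Counting.
Variables (R : realType) (S : seq int).

Local Notation N := (ngad S).
Local Notation T := (gterrain R S).
Implicit Types (w : point3 R).

(** The plane through the vertex orthogonal to (p, q, 1) has slopes -p and -q. *)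
Lemma convex_of_max (p q : R) i :
  (forall j, neighbors T i j -> dot3 (vertex T j) ((p, q), 1) < dot3 (vertex T i) ((p, q), 1)) ->
  convex_vertex T i.
Proof.
move=> lm; exists (- p), (- q) => j /lm; rewrite /dot3 /proj /=.
by move: (vertex T i) (vertex T j) => [[? ?] ?] [[? ?] ?] /=; lra.
Qed.

Lemma internal_peak j : (j < N)%N -> internal T (3 * j).+4.
Proof.
move=> jN; have E := comb_peak R jN.
rewrite /corners /= !big_cons big_nil addr0 addrA in E.
apply: internal_inside E; try exact: wtv_gt0.
- by apply: (neighborsI (t := (0, (3 * j).+1.+4, (3 * j).+4)%N));
    [rewrite (mem_tri6 _ jN)// !inE eqxx ?orbT | rewrite ?inE /=; lia ..].
- by apply: (neighborsI (t := ((3 * j).+4, (3 * j).+1.+4, (3 * j).+2)%N));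
    [rewrite (mem_tri6 _ jN)// !inE eqxx ?orbT | rewrite ?inE /=; lia ..].
- by apply: (neighborsI (t := (0, (3 * j).+4, (3 * j).+2)%N));
    [rewrite (mem_tri6 _ jN)// !inE eqxx ?orbT | rewrite ?inE /=; lia ..].
- exact: (nondegenerate_A R jN).
- exact: wtv_sum.
Qed.

Lemma internal_spike j : (j <= N)%N -> internal T (3 * j).+3.
Proof.
rewrite leq_eqVlt => /orP[/eqP ->|jN].
  have E := comb_last_spike R S.
  rewrite /corners /= !big_cons big_nil addr0 addrA in E.
  apply: internal_inside E; try exact: third_gt0.
  - by apply: neighbors_last; rewrite ?inE ?eqxx ?orbT.
  - by apply: neighbors_last; rewrite ?inE ?eqxx ?orbT.
  - by apply: neighbors_last; rewrite ?inE ?eqxx ?orbT.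
  - exact: (nondegenerate_stage R (leqnn N)).
  - exact: third_sum.
have E := comb_spike R jN.
rewrite /corners /= !big_cons big_nil addr0 addrA in E.
apply: internal_inside E; try exact: third_gt0.
- by apply: (neighborsI (t := ((3 * j).+1.+4, 1, (3 * j).+3)%N));
    [rewrite (mem_tri6 _ jN)// !inE eqxx ?orbT | rewrite ?inE /=; lia ..].
- by apply: (neighborsI (t := ((3 * j).+3, 1, (3 * j).+2)%N));
    [rewrite (mem_tri6 _ jN)// !inE eqxx ?orbT | rewrite ?inE /=; lia ..].
- by apply: (neighborsI (t := ((3 * j).+1.+4, (3 * j).+3, (3 * j).+2)%N));
    [rewrite (mem_tri6 _ jN)// !inE eqxx ?orbT | rewrite ?inE /=; lia ..].
- exact: (nondegenerate_B R jN).
- exact: third_sum.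
Qed.

(* Cliques have numbers up to N, and the peaks of each direction share one number above N. *)
Definition cls (i : nat) : nat :=
  match i with
  | m.+2 => if (m %% 3 < 2)%N then (m %/ 3)%N else (N.+1 + (m %/ 3) %% 3)%N
  | _ => N
  end.

Lemma cls_spike j : cls (3 * j).+3 = j.
Proof.
rewrite /cls; have -> : ((3 * j).+1 %% 3 = 1)%N by lia.
by rewrite /=; lia.
Qed.

Lemma cls_peak j : cls (3 * j).+4 = (N.+1 + j %% 3)%N.
Proof.
rewrite /cls; have -> : ((3 * j).+2 %% 3 = 2)%N by lia.
by have -> : ((3 * j).+2 %/ 3 = j)%N by lia.
Qed.

Lemma clsP i : (i < (3 * N).+4)%N ->
  [\/ (exists2 j, (j < N)%N & cls i = j /\ (i = (3 * j).+2 \/ i = (3 * j).+3)),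
      cls i = N /\ i \in [:: 0; 1; (3 * N).+2; (3 * N).+3]%N |
      exists2 j, (j < N)%N & cls i = (N.+1 + j %% 3)%N /\ i = (3 * j).+4].
Proof.
case: i => [|[|m]] mN; [by constructor 2; rewrite !inE..|].
have := divn_eq m 3; have := ltn_pmod m (isT : 0 < 3)%N.
have [m2|m2] := ltnP (m %% 3) 2 => m3 mE; last first.
  constructor 3; exists (m %/ 3)%N; first lia.
  by split; [rewrite /cls ltnNge m2 | lia].
have cE : cls m.+2 = (m %/ 3)%N by rewrite /cls m2.
have [j|j] := ltnP (m %/ 3) N.
  by constructor 1; exists (m %/ 3)%N => //; split=> //; lia.
by constructor 2; rewrite cE !inE; lia.
Qed.

Lemma dxE j : xP R j.+1 - xP R j =
  if (j %% 3 == 0)%N then 1 else if (j %% 3 == 1)%N then -1 else 0.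
Proof.
rewrite /xP; have -> : (j.+1 %% 3 == 1)%N = (j %% 3 == 0)%N by apply/idP/idP; lia.
case: (eqVneq (j %% 3) 0)%N => [->|j0]; first by rewrite subr0.
by case: (j %% 3 == 1)%N; rewrite /= ?mulr0n ?sub0r ?oppr0.
Qed.

(** Two parallel strips of half-width 1/4 can meet only if their [sigma] differ by less than 1/2.
    Even after undoing the halving in the third direction, the two integers differ by less than
    1. *)
Lemma peaks_inj w j j' : uniq S -> (j < N)%N -> (j' < N)%N -> (j %% 3 = j' %% 3)%N ->
  local_max T w (3 * j).+4 -> local_max T w (3 * j').+4 -> j = j'.
Proof.
move=> uS jN j'N jj' /(peak_strip jN)[w0 h] /(peak_strip j'N)[_ h'].
have dd : xP R j.+1 - xP R j = xP R j'.+1 - xP R j' by rewrite !dxE jj'.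
rewrite dd in h; set l := _ * _ - _ in h h'.
have ss : `|sigma R S j - sigma R S j'| < 1 / 2.
  have : w.2 * `|sigma R S j - sigma R S j'| < w.2 * (1 / 2).
    rewrite -[X in X * _](gtr0_norm w0) -normrM.
    move: h h'; rewrite !ltr_norml => /andP[h1 h2] /andP[h3 h4].
    by apply/andP; split; lra.
  by rewrite ltr_pM2l.
have ee : `|elt R S (j %/ 3) - elt R S (j' %/ 3)| < 1.
  move: ss; rewrite /sigma jj'; case: ifP => _.
    by move=> ss; apply: lt_trans ss _; lra.
  by rewrite !ltr_norml => /andP[? ?]; apply/andP; split; lra.
have eS : nth 0 S (j %/ 3) = nth 0 S (j' %/ 3).
  move: ee; rewrite /elt -intrB -intr_norm -[1]/(1%:~R) ltr_int => ee.
  by apply/eqP; rewrite -subr_eq0 -normr_eq0; lia.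
have : (j %/ 3 == j' %/ 3)%N.
  have jS : (j %/ 3 < size S)%N by rewrite ltn_divLR// mulnC.
  have j'S : (j' %/ 3 < size S)%N by rewrite ltn_divLR// mulnC.
  by rewrite -(nth_uniq 0 jS j'S uS) eS.
by move=> /eqP de; rewrite (divn_eq j 3) (divn_eq j' 3) de jj'.
Qed.

(** Adjacent vertices cannot both be strict maxima, which settles the cliques; [peaks_inj] settles
    the peaks. *)
Lemma cls_inj w i i' : uniq S -> (i < (3 * N).+4)%N -> (i' < (3 * N).+4)%N ->
  local_max T w i -> local_max T w i' -> cls i = cls i' -> i = i'.
Proof.
move=> uS iN i'N lm lm' cE.
apply/eqP; apply/negPn/negP => ne.
have adj : ~~ neighbors T i i'.
  apply/negP => nb; have nb' : neighbors T i' i by rewrite neighborsC.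
  by have := lt_trans (lm _ nb) (lm' _ nb'); rewrite ltxx.
case: (clsP iN) (clsP i'N) => [[j jN [c iE]]|[c i4]|[j jN [c iE]]]
  [[j' j'N [c' i'E]]|[c' i'4]|[j' j'N [c' i'E]]]; try lia.
- have jj' : j' = j by lia.
  have nb := neighbors_spikeP R (ltnW jN).
  move: adj ne; rewrite jj' in i'E; case: iE i'E => -> [] ->; rewrite ?eqxx ?nb//.
  by rewrite neighborsC nb.
- by move: adj; rewrite neighbors_last.
- move: ne; rewrite iE i'E (peaks_inj (w := w) uS jN j'N) ?eqxx//; first lia.
    by rewrite -iE.
  by rewrite -i'E.
Qed.

End Counting.

(** * Prickliness and 3SUM *)

Lemma edivn3 i r : (r < 3)%N -> ((3 * i + r) %/ 3 = i)%N /\ ((3 * i + r) %% 3 = r)%N.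
Proof. lia. Qed.

Lemma ltn3D i r n : (i < n)%N -> (r < 3)%N -> (3 * i + r < 3 * n)%N.
Proof. lia. Qed.

Lemma int_norm_lt1 (z : int) : `|z| < 1 -> z = 0.
Proof. lia. Qed.

Section Threshold.
Variables (R : realType) (S : seq int).

Local Notation N := (ngad S).
Local Notation T := (gterrain R S).
Implicit Types (w : point3 R).

Lemma peaks_threesum w j0 j1 j2 : (j0 < N)%N -> (j1 < N)%N -> (j2 < N)%N ->
  (j0 %% 3 = 0)%N -> (j1 %% 3 = 1)%N -> (j2 %% 3 = 2)%N ->
  local_max T w (3 * j0).+4 -> local_max T w (3 * j1).+4 -> local_max T w (3 * j2).+4 ->
  threesum_yes S.
Proof.
move=> j0N j1N j2N m0 m1 m2 /(peak_strip j0N)[w0 h0] /(peak_strip j1N)[_ h1]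
  /(peak_strip j2N)[_ h2].
have mS j : (j < N)%N -> nth 0 S (j %/ 3) \in S.
  by move=> jN; rewrite mem_nth// ltn_divLR// mulnC.
exists (nth 0 S (j0 %/ 3)), (nth 0 S (j1 %/ 3)), (nth 0 S (j2 %/ 3)); split; try exact: mS.
set a := nth _ _ _; set b := nth _ _ _; set c := nth _ _ _.
move: h0 h1 h2; rewrite !dxE /sigma m0 m1 m2 /= /elt -/a -/b -/c.
rewrite !ltr_norml => /andP[h0 h0'] /andP[h1 h1'] /andP[h2 h2'].
(* With coefficients 1, 1, -2 the three strip terms add up to -w.2 (a + b + c), and 1/4 + 1/4 + 2/4
   = 1. *)
have : `|a%:~R + b%:~R + c%:~R : R| < 1.
  have : w.2 * `|a%:~R + b%:~R + c%:~R| < w.2 * 1.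
    rewrite -[X in X * _](gtr0_norm w0) -normrM ltr_norml.
    by apply/andP; split; lra.
  by rewrite ltr_pM2l.
rewrite -!intrD -intr_norm -[1]/(1%:~R) ltr_int => abc.
exact: int_norm_lt1.
Qed.

Definition counted w : {set 'I_(size (verts T))} :=
  [set i : 'I_(size (verts T)) |
      `[< [/\ internal T i, convex_vertex T i & local_max T w i] >] ]%SET.

Lemma prickliness_dirE w : prickliness_dir T w = #|counted w|.
Proof. by []. Qed.

Lemma countedP w (i : 'I_(size (verts T))) : reflect [/\ internal T i, convex_vertex T i & local_max T w i]
  (i \in counted w).
Proof. by rewrite inE; apply: asboolP. Qed.

Lemma cls_lt i : (i < (3 * N).+4)%N -> (cls S i < N.+4)%N.
Proof. by move=> /(clsP (S := S)) [[j jN [-> _]]|[-> _]|[j jN [-> _]]]; lia. Qed.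

Lemma ord_lt (i : 'I_(size (verts T))) : (i < (3 * N).+4)%N.
Proof. by rewrite -(size_verts R S) ltn_ord. Qed.

Definition clsO (i : 'I_(size (verts T))) : 'I_N.+4 := inord (cls S i).

Lemma val_clsO i : val (clsO i) = cls S i.
Proof. by rewrite /= inordK// cls_lt// ord_lt. Qed.

(** The counted vertices inject into N + 4 classes. If they fill all classes, one direction is a
    local maximum for a peak of each of the three kinds. *)
Lemma prickliness_dir_ge_threesum w : uniq S -> (N.+4 <= prickliness_dir T w)%N ->
  threesum_yes S.
Proof.
move=> uS; rewrite prickliness_dirE.
have inj : {in counted w &, injective clsO}.
  move=> i i' /countedP[_ _ lm] /countedP[_ _ lm'] /(congr1 val).
  rewrite !val_clsO => cE; apply: val_inj.
  exact: cls_inj uS (ord_lt i) (ord_lt i') lm lm' cE.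
rewrite -(card_in_imset inj) => full.
have {full} imT : clsO @: counted w = [set: 'I_N.+4]%SET.
  by apply/eqP; rewrite eqEcard finset.subsetT cardsT card_ord.
have pk r : (r < 3)%N -> exists j, [/\ (j < N)%N, (j %% 3 = r)%N & local_max T w (3 * j).+4].
  move=> r3; have rN : (N.+1 + r < N.+4)%N by lia.
  have : Ordinal rN \in clsO @: counted w by rewrite imT inE.
  move=> /imsetP[i /countedP[_ _ lm] /(congr1 val)]; rewrite val_clsO /= => rE.
  have [[j jN [cE _]]|[cE _]|[j jN [cE iE]]] := clsP (ord_lt i); try by move: rE; rewrite cE; lia.
  exists j; split => //; last by rewrite -iE.
  by apply/esym/(@addnI N.+1); rewrite -cE -rE.
have [j0 [j0N m0 l0]] := pk 0%N isT; have [j1 [j1N m1 l1]] := pk 1%N isT.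
have [j2 [j2N m2 l2]] := pk 2 isT.
exact: (peaks_threesum j0N j1N j2N m0 m1 m2 l0 l1 l2).
Qed.

Lemma norm_mem_le (z : int) : z \in S -> `|z%:~R : R| <= bigQ R S.
Proof.
move=> zS; apply: (le_trans (norm_int_le_sqr R z)).
rewrite /bigQ (big_rem z zS) /= addrCA lerDl addr_ge0// sumr_ge0// => y _.
exact: sqr_ge0.
Qed.

Lemma threesum_prickliness_dir : threesum_yes S ->
  exists w, (N.+4 <= prickliness_dir T w)%N.
Proof.
move=> [a [b [c [aS bS cS abc]]]].
have aQ := norm_mem_le aS; have bQ := norm_mem_le bS.
(* The intersection of p - q = a and -p - q = b; as a + b = -c, it also lies on -q = -c/2. *)
pose p : R := (a%:~R - b%:~R) / 2; pose q : R := - (a%:~R + b%:~R) / 2.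
have pQ : `|p| <= bigQ R S.
  by move: aQ bQ; rewrite /p !ler_norml => /andP[? ?] /andP[? ?]; apply/andP; split; lra.
have qQ : `|q| <= bigQ R S.
  by move: aQ bQ; rewrite /q !ler_norml => /andP[? ?] /andP[? ?]; apply/andP; split; lra.
exists ((p, q), 1); rewrite prickliness_dirE.
(* A counted vertex in every class gives the lower bound. *)
suff sub : [set: 'I_N.+4]%SET \subset clsO @: counted ((p, q), 1).
  by rewrite -[leqLHS]card_ord -cardsT (leq_trans (subset_leq_card sub))// leq_imset_card.
have pick (i k : nat) : (i < (3 * N).+4)%N -> cls S i = k -> internal T i ->
    (forall j, neighbors T i j ->
       dot3 (vertex T j) ((p, q), 1) < dot3 (vertex T i) ((p, q), 1)) ->
    exists2 i' : 'I_(size (verts T)), i' \in counted ((p, q), 1) & cls S i' = k.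
  rewrite -(size_verts R S) => iN cE ii lm; exists (Ordinal iN) => //.
  by apply/countedP; split => //; exact: convex_of_max lm.
have strip (z : int) r : z \in S -> (r < 3)%N ->
    p * (if r == 0%N then 1 else if r == 1%N then -1 else 0) - q =
      (if (r < 2)%N then z%:~R else - (z%:~R / 2)) ->
    exists2 i : 'I_(size (verts T)), i \in counted ((p, q), 1) & cls S i = (N.+1 + r)%N.
  move=> zS r3 E; pose j := (3 * index z S + r)%N.
  have [jd jm] := edivn3 (index z S) r3; rewrite -/j in jd jm.
  have jN : (j < N)%N by apply: ltn3D; rewrite ?index_mem.
  apply: (pick (3 * j).+4).
  - by rewrite -[ltnLHS]addn4 -[ltnRHS]addn4 ltn_add2r ltn_pmul2l.
  - by rewrite cls_peak jm.
  - exact: internal_peak.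
  - by move=> i; apply: peak_max => //; rewrite dxE /sigma /elt jm jd nth_index.
have cE : c%:~R = - (a%:~R + b%:~R) :> R.
  by rewrite -intrD -intrN; congr (_%:~R); lia.
apply/fintype.subsetP => k _; apply/imsetP.
suff [i ic iE] : exists2 i : 'I_(size (verts T)), i \in counted ((p, q), 1) & cls S i = k.
  by exists i => //; apply: val_inj; rewrite val_clsO.
have kN := ltn_ord k.
have [kle|kgt] := leqP k N.
  apply: (pick (3 * k).+3); first lia.
  - exact: cls_spike.
  - exact: internal_spike.
  - by move=> i; exact: spike_max.
have : [\/ k = (N.+1 + 0)%N :> nat, k = (N.+1 + 1)%N :> nat | k = (N.+1 + 2)%N :> nat].
  have [|h] := eqVneq (k : nat) (N.+1 + 0)%N; first by constructor 1.
  have [|h'] := eqVneq (k : nat) (N.+1 + 1)%N; first by constructor 2.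
  by constructor 3; lia.
case=> ->.
- by apply: (strip a) => //=; rewrite /p /q; field.
- by apply: (strip b) => //=; rewrite /p /q; field.
- by apply: (strip c) => //=; rewrite cE /p /q; field.
Qed.

Lemma prickliness_dir_max w : (prickliness_dir T w <= prickliness T)%N.
Proof.
have wk : (prickliness_dir T w < (size (verts T)).+1)%N.
  by rewrite ltnS prickliness_dirE -[leqRHS]card_ord max_card.
apply: (@leq_bigmax_cond _ _ (fun k : 'I__ => k : nat) (Ordinal wk)).
by apply/asboolP; exists w.
Qed.

(** Keeps the answer of the oracle within the word bound. *)
Lemma prickliness_le : (prickliness T <= (3 * N).+4)%N.
Proof. by apply/bigmax_leqP => k _; rewrite -(size_verts R S) -ltnS. Qed.

Lemma prickliness_threesum : uniq S ->
  (N.+4 <= prickliness T)%N = `[< threesum_yes S >].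
Proof.
move=> uS; apply/idP/asboolP => [le|/threesum_prickliness_dir[w le]]; last first.
  exact: leq_trans le (prickliness_dir_max w).
apply: contrapT => no; move: le; rewrite leqNgt => /negP; apply.
rewrite ltnS; apply/bigmax_leqP => k /asboolP[w wk].
rewrite leqNgt; apply/negP => kN; apply: no.
by apply: (prickliness_dir_ge_threesum (w := w) uS); rewrite wk.
Qed.

End Threshold.

(** * Running programs *)

Section Hoare.
Variables (R : realType) (W : nat) (P : problem R).
Implicit Types (s : state R) (c : cmd) (Q : state R -> Prop) (B : nat).

(** Meant for the oracle-free parts of the program; the single query is run separately. *)
Definition halts c s B Q : Prop :=
  exists s' t, [/\ exec W P c s s' t [::], (t <= B)%N & Q s'].

Lemma halts_seq c1 c2 s B1 B2 Q1 Q2 : halts c1 s B1 Q1 ->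
  (forall s', Q1 s' -> halts c2 s' B2 Q2) -> halts (Seq c1 c2) s (B1 + B2) Q2.
Proof.
move=> [s1 [t1 [e1 tB1 q1]]] /(_ _ q1)[s2 [t2 [e2 tB2 q2]]].
exists s2, (t1 + t2)%N; split => //; last exact: leq_add.
by rewrite -[[::]]/([::] ++ [::]); exact: ExSeq e1 e2.
Qed.

Lemma halts_imp c s B Q Q' : halts c s B Q -> (forall s', Q s' -> Q' s') -> halts c s B Q'.
Proof. by move=> [s' [t [e tB q]]] QQ'; exists s', t; split => //; exact: QQ'. Qed.

Lemma halts_iset x e s Q : (ieval s e <= W)%N -> Q (set_ivar s x (ieval s e)) ->
  halts (ISet x e) s 1 Q.
Proof. by move=> eW q; exists (set_ivar s x (ieval s e)), 1%N; split => //; exact: ExISet. Qed.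

Lemma halts_rset x e s Q : Q (set_rvar s x (reval s e)) -> halts (RSet x e) s 1 Q.
Proof. by move=> q; exists (set_rvar s x (reval s e)), 1%N; split => //; exact: ExRSet. Qed.

Lemma halts_while b c s B n (Inv : nat -> state R -> Prop) :
  (forall k s, (k < n)%N -> Inv k s -> beval s b /\ halts c s B (Inv k.+1)) ->
  (forall s, Inv n s -> ~~ beval s b) ->
  Inv 0%N s -> halts (While b c) s (n * B.+1).+1 (Inv n).
Proof.
move=> step stop.
suff H m : forall k s, (k + m)%N = n -> Inv k s ->
    halts (While b c) s (m * B.+1).+1 (Inv n).
  by move=> I0; apply: (H n 0%N).
elim: m => [|m IH] k {}s km Ik.
  exists s, 1%N; split => //; last by rewrite -km addn0.
  by apply: ExWhileF; apply: stop; rewrite -km addn0.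
have [bt [s1 [t1 [e1 tB1 I1]]]] := step k s (ltac:(lia)) Ik.
have [s2 [t2 [e2 tB2 I2]]] := IH k.+1 s1 (ltac:(lia)) I1.
exists s2, (t1 + t2).+1; split => //; last by rewrite mulSn; lia.
by rewrite -[[::]]/([::] ++ [::]); exact: ExWhileT bt e1 e2.
Qed.

(* Everything except the output arrays 1 and the pointers 3 and 4 to their ends. *)
Definition agree s s' : Prop :=
  [/\ rvar s' = rvar s, forall x, x != 3%N -> x != 4%N -> ivar s' x = ivar s x,
      iarr s' 0%N = iarr s 0%N & rarr s' 0%N = rarr s 0%N].

Lemma agree_trans s1 s2 s3 : agree s1 s2 -> agree s2 s3 -> agree s1 s3.
Proof.
move=> [r1 i1 a1 b1] [r2 i2 a2 b2]; split; rewrite ?r2 ?a2 ?b2//.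
by move=> x x3 x4; rewrite i2// i1.
Qed.

(** Expressions whose value no push can change, so that a whole list of them may be evaluated in the
    state before the first push. *)
Fixpoint input_iexpr (e : iexpr) : bool :=
  match e with
  | IVar x => (x != 3%N) && (x != 4%N)
  | ICst _ => true
  | IGet a e1 => (a == 0%N) && input_iexpr e1
  | IAdd e1 e2 | ISub e1 e2 => input_iexpr e1 && input_iexpr e2
  end.

Fixpoint input_rexpr (e : rexpr) : bool :=
  match e with
  | RVar _ | RCst _ => true
  | RGet a e1 => (a == 0%N) && input_iexpr e1
  | RAdd e1 e2 | RSub e1 e2 | RMul e1 e2 | RDiv e1 e2 =>
      input_rexpr e1 && input_rexpr e2
  end.

Lemma ieval_agree s s' e : agree s s' -> input_iexpr e -> ieval s' e = ieval s e.
Proof.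
move=> [rE iE aE bE]; elim: e => //= [x /andP[x3 x4]|a e IH /andP[/eqP -> /IH ->]
  |e1 IH1 e2 IH2 /andP[/IH1 -> /IH2 ->]|e1 IH1 e2 IH2 /andP[/IH1 -> /IH2 ->]] //.
  exact: iE.
by rewrite aE.
Qed.

Lemma reval_agree s s' e : agree s s' -> input_rexpr e -> reval s' e = reval s e.
Proof.
move=> A; have [rE iE aE bE] := A; elim: e => //= [x _|a e /andP[/eqP -> ie]
  |e1 IH1 e2 IH2 /andP[/IH1 -> /IH2 ->]|e1 IH1 e2 IH2 /andP[/IH1 -> /IH2 ->]
  |e1 IH1 e2 IH2 /andP[/IH1 -> /IH2 ->]|e1 IH1 e2 IH2 /andP[/IH1 -> /IH2 ->]] //.
  by rewrite rE.
by rewrite bE (ieval_agree A).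
Qed.

Definition output s (lw : seq nat) (lr : seq R) : Prop :=
  [/\ stores (iarr s 1%N) lw, ivar s 3 = size lw, stores (rarr s 1%N) lr &
      ivar s 4 = size lr].

Lemma stores_rcons (U : Type) (arr : nat -> U) l (v : U) :
  stores arr l -> stores (upd arr (size l) v) (rcons l v).
Proof.
move=> st x0 i; rewrite size_rcons ltnS nth_rcons /upd.
by case: ltngtP => // il _; exact: st.
Qed.

Definition pushr (es : seq rexpr) : cmd :=
  foldr (fun e c => Seq (RPut 1 (IVar 4) e)
    (Seq (ISet 4 (IAdd (IVar 4) (ICst 1))) c)) Skip es.

Definition pushw (es : seq iexpr) : cmd :=
  foldr (fun e c => Seq (IPut 1 (IVar 3) e)
    (Seq (ISet 3 (IAdd (IVar 3) (ICst 1))) c)) Skip es.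

Lemma halts_pushr es s lw lr : all input_rexpr es -> output s lw lr ->
  (size lr + size es <= W)%N ->
  halts (pushr es) s (2 * size es)
    (fun s' => agree s s' /\ output s' lw (lr ++ map (reval s) es)).
Proof.
elim: es s lr => [|e es IH] s lr /=.
  by move=> _ o _; exists s, 0%N; split => //; [exact: ExSkip|rewrite cats0].
move=> /andP[ie ies] [sw pw sr pr] lW; rewrite mulnS addnC.
pose s1 := set_rarr s 1 (ivar s 4) (reval s e).
pose s2 := set_ivar s1 4 (ivar s 4 + 1).
have A : agree s s2 by split => // x x3 x4; rewrite /= /upd (negbTE x4).
have O : output s2 lw (rcons lr (reval s e)).
  split => //=; last by rewrite size_rcons pr addn1.
  by rewrite pr; exact: stores_rcons.
have l2 : (size (rcons lr (reval s e)) + size es <= W)%N by rewrite size_rcons; lia.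
have [s3 [t [ex tB [A3 O3]]]] := IH s2 _ ies O l2.
exists s3, (1 + (1 + t))%N; split; last 1 first.
- split; first exact: agree_trans A A3.
  rewrite -cat_rcons; suff <- : map (reval s2) es = map (reval s) es by [].
  by elim: (es) ies => //= f fs IHf /andP[jf jfs]; rewrite IHf// (reval_agree A).
- rewrite -[[::]]/([::] ++ ([::] ++ [::])); apply: ExSeq; last apply: ExSeq; last exact: ex.
    by apply: ExRPut => /=; rewrite pr; lia.
  by apply: ExISet => /=; rewrite /upd/= pr; lia.
- by lia.
Qed.

Lemma halts_pushw es s lw lr : all input_iexpr es -> output s lw lr ->
  all (fun e => ieval s e <= W)%N es ->
  (size lw + size es <= W)%N ->
  halts (pushw es) s (2 * size es)
    (fun s' => agree s s' /\ output s' (lw ++ map (ieval s) es) lr).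
Proof.
elim: es s lw => [|e es IH] s lw /=.
  by move=> _ o _ _; exists s, 0%N; split => //; [exact: ExSkip|rewrite cats0].
move=> /andP[ie ies] [sw pw sr pr] /andP[eW esW] lW; rewrite mulnS addnC.
pose s1 := set_iarr s 1 (ivar s 3) (ieval s e).
pose s2 := set_ivar s1 3 (ivar s 3 + 1).
have A : agree s s2 by split => // x x3 x4; rewrite /= /upd (negbTE x3).
have O : output s2 (rcons lw (ieval s e)) lr.
  split => //=; last by rewrite size_rcons pw addn1.
  by rewrite pw; exact: stores_rcons.
have l2 : (size (rcons lw (ieval s e)) + size es <= W)%N by rewrite size_rcons; lia.
have mE : map (ieval s2) es = map (ieval s) es.
  by elim: (es) ies => //= f fs IHf /andP[jf jfs]; rewrite IHf// (ieval_agree A).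
have esW2 : all (fun e => ieval s2 e <= W)%N es.
  by rewrite -(all_map (ieval s2) (fun x => x <= W)%N) mE all_map.
have [s3 [t [ex tB [A3 O3]]]] := IH s2 _ ies O esW2 l2.
exists s3, (1 + (1 + t))%N; split; last 1 first.
- split; first exact: agree_trans A A3.
  by rewrite -cat_rcons -mE.
- rewrite -[[::]]/([::] ++ ([::] ++ [::])); apply: ExSeq; last apply: ExSeq; last exact: ex.
    by apply: ExIPut => //=; rewrite pw; lia.
  by apply: ExISet => /=; rewrite /upd/= pw; lia.
- by lia.
Qed.

End Hoare.

(** * The program *)

(* Word variables: 1 the number of integers, 2 a loop counter, 3 and 4 the ends of the
   output arrays, 5 the index of the current [ptP].  Real variables: 0 [bigQ], 1 [ngad],
   2 [bigK], 3 [bigH], 4 [eta], 5 to 7 the current [ptP], 8 its [sigma]. *)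
Definition ax : rexpr := RSub (RCst 0) (RVar 2).
Definition bx : rexpr := RVar 2.
Definition aby : rexpr := RSub (RCst 0) (RAdd (RVar 1) (RCst 1)).
Definition abz : rexpr := RSub (RCst 0) (RVar 3).

Definition third (u v w : rexpr) : rexpr := RDiv (RAdd (RAdd u v) w) (RCst 3).

Definition mix (a u v : rexpr) : rexpr :=
  RAdd (RMul (RDiv (RSub (RCst 1) (RVar 4)) (RCst 2)) (RAdd u v)) (RMul (RVar 4) a).

Definition gadget_verts (dx : int) : seq rexpr :=
  let x' := RAdd (RVar 5) (RCst dx) in
  let y' := RSub (RVar 6) (RCst 1) in
  let z' := RSub (RVar 7) (RVar 8) in
  [:: third bx (RVar 5) x'; third aby (RVar 6) y'; RVar 3;
      mix ax (RVar 5) x'; mix aby (RVar 6) y';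
      RAdd (mix abz (RVar 7) z') (RDiv (RCst 1) (RCst 16));
      x'; y'; z'].

Definition gadget_tris : seq iexpr :=
  let p := IVar 5 in
  let s := IAdd (IVar 5) (ICst 1) in
  let v := IAdd (IVar 5) (ICst 2) in
  let p' := IAdd (IVar 5) (ICst 3) in
  [:: s; ICst 1; p; p'; s; p; p'; ICst 1; s; v; p'; p; ICst 0; v; p; ICst 0; p'; v].

(** Registers 5 to 7 move on only after the pushes, since all pushed values refer to the old chain
    vertex. *)
Definition gadget (dx : int) (e : rexpr) : cmd :=
  Seq (RSet 8 e) (Seq (pushr (gadget_verts dx)) (Seq (pushw gadget_tris)
  (Seq (RSet 5 (RAdd (RVar 5) (RCst dx))) (Seq (RSet 6 (RSub (RVar 6) (RCst 1)))
  (Seq (RSet 7 (RSub (RVar 7) (RVar 8))) (ISet 5 (IAdd (IVar 5) (ICst 3)))))))).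

Definition cur : rexpr := RGet 0 (IVar 2).
Definition next : cmd := ISet 2 (IAdd (IVar 2) (ICst 1)).
Definition more : bexpr := BNot (ILe (IVar 1) (IVar 2)).

(** A separate pass, because the very first vertex already depends on [bigQ]. Real register 1 grows
    in steps of 3, as no expression turns a word into a real. *)
Definition scan_body : cmd :=
  Seq (RSet 0 (RAdd (RVar 0) (RMul cur cur))) (Seq (RSet 1 (RAdd (RVar 1) (RCst 3))) next).

Definition build_body : cmd :=
  Seq (gadget 1 cur) (Seq (gadget (-1) cur)
    (Seq (gadget 0 (RSub (RCst 0) (RDiv cur (RCst 2)))) next)).

(** Words have no multiplication; [k] is a constant of the program, so the expression has constant
    size. *)
Definition imul (k : nat) (e : iexpr) : iexpr := iter k (IAdd e) (ICst 0).

Definition constants : cmd :=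
  Seq (RSet 2 (RAdd (RMul (RCst 2) (RVar 1)) (RCst 4)))
  (Seq (RSet 3 (RMul (RVar 0) (RAdd (RMul (RCst 6) (RVar 1)) (RCst 20))))
  (Seq (RSet 4 (RDiv (RCst 1) (RMul (RCst 64) (RVar 3))))
  (Seq (ISet 2 (ICst 0)) (ISet 5 (ICst 2))))).

Definition first_verts : seq rexpr :=
  [:: ax; aby; abz; bx; aby; abz; RCst 0; RCst 0; RCst 0].

Definition sizes : seq iexpr :=
  [:: IAdd (imul 9 (IVar 1)) (ICst 4); IAdd (imul 18 (IVar 1)) (ICst 3)].

Definition last_verts : seq rexpr :=
  [:: third ax bx (RVar 5); third aby aby (RVar 6); RVar 3].

Definition last_tris : seq iexpr :=
  let p := IVar 5 in
  let s := IAdd (IVar 5) (ICst 1) in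
  [:: s; ICst 1; p; ICst 0; s; p; ICst 0; ICst 1; s].

Definition program : cmd :=
  Seq (Seq (ISet 1 (IGet 0 (ICst 0))) (Seq (RSet 0 (RCst 1))
    (Seq (While more scan_body) (Seq constants
    (Seq (Seq (pushr first_verts) (pushw sizes))
    (Seq (While more build_body) (Seq (pushr last_verts) (pushw last_tris))))))))
  (Seq (Query 1 1 0)
    (If (ILe (IAdd (imul 3 (IVar 1)) (ICst 4)) (IVar 0)) (ISet 0 (ICst 1)) (ISet 0 (ICst 0)))).

(** * Correctness and running time of the construction phase *)

Section Run.
Variables (R : realType) (S : seq int) (W : nat).
(** Room for the output pointers: with n integers, the arrays end with 54n + 11 words and 27n + 12
    reals. *)
Hypothesis bigW : (54 * size S + 12 <= W)%N.

Local Notation N := (ngad S).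
Local Notation T := (gterrain R S).
Local Notation halts := (@halts R W (prickliness_problem R)).

Definition coords (v : point3 R) : seq R := [:: v.1.1; v.1.2; v.2].

Definition gadget_points (j : nat) : seq (point3 R) :=
  [:: spike R S j; peak R S j; ptP R S j.+1].

Definition points (j : nat) : seq (point3 R) :=
  [:: ptA R S; ptB R S; ptP R S 0] ++ flatten (mkseq gadget_points j).

Definition out_words (j : nat) : seq nat :=
  [:: 3 * N + 4; 6 * N + 3]%N ++ flatten (map corners (flatten (mkseq tri6 j))).

Definition out_reals (j : nat) : seq R := flatten (map coords (points j)).

Lemma pointsE j : points j = mkseq (gvert R S) (3 * j).+3.
Proof.
elim: j => [|j IH].
  by rewrite /points /mkseq /= -(gvertP R S 0).
have -> : (3 * j.+1).+3 = (3 * j).+3.+3 by lia.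
rewrite 3!mkseqS -!cats1 -IH /points mkseqS flatten_rcons -!catA.
congr (_ ++ (_ ++ _)).
by rewrite gvert_spike gvert_peak -[(3 * j).+3.+2]/(3 * j).+1.+4 gvertP'.
Qed.

Lemma gterrain_words : enc_words (T : instance (prickliness_problem R)) =
  out_words N ++ flatten (map corners (tri3 S)).
Proof.
have szf : size (flatten (mkseq tri6 N)) = (6 * N)%N.
  by elim: (ngad S) => // k IH; rewrite flatten_tri6S size_cat IH /=; lia.
have sT : size (tris T) = (6 * N + 3)%N by rewrite size_cat szf.
rewrite -[LHS]/[:: size (verts T), size (tris T) & flatten (map corners (tris T))].
rewrite size_verts sT /out_words -catA -flatten_cat -map_cat.
by congr [:: _, _ & _]; rewrite addn4.
Qed.

Lemma gterrain_reals : enc_reals (T : instance (prickliness_problem R)) =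
  out_reals N ++ coords (spike R S N).
Proof.
rewrite /out_reals pointsE -gvert_spike.
rewrite -[LHS]/(flatten (map coords (mkseq (gvert R S) (3 * N).+4))).
by rewrite mkseqS map_rcons flatten_rcons.
Qed.

Lemma size_out_words j : size (out_words j) = (18 * j + 2)%N.
Proof.
rewrite size_cat /=; elim: j => // j IH.
by rewrite flatten_tri6S map_cat flatten_cat size_cat /=; lia.
Qed.

Lemma size_out_reals j : size (out_reals j) = (9 * j + 9)%N.
Proof.
rewrite /out_reals pointsE.
have E (l : seq (point3 R)) : size (flatten (map coords l)) = (3 * size l)%N.
  by elim: l => //= v l IH; rewrite IH; lia.
by rewrite E size_mkseq; lia.
Qed.

(** [i] counts the integers consumed and [j] the gadgets written; within one loop body only [j]
    advances until the end. *)
Record building (i j : nat) (lw : seq nat) (lr : seq R) (s : state R) : Prop := Building {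
  bn : ivar s 1 = size S;
  bi : ivar s 2 = i;
  bp : ivar s 5 = (3 * j).+2;
  bN : rvar s 1 = N%:R;
  bK : rvar s 2 = bigK R S;
  bH : rvar s 3 = bigH R S;
  be : rvar s 4 = eta R S;
  bx5 : rvar s 5 = xP R j;
  by6 : rvar s 6 = - j%:R;
  bz7 : rvar s 7 = zP R S j;
  bin : forall k, (k < size S)%N -> rarr s 0 k = elt R S k;
  bout : output s lw lr }.

Lemma building_agree i j lw lr lw' lr' s s' : building i j lw lr s -> agree s s' ->
  output s' lw' lr' -> building i j lw' lr' s'.
Proof.
by move=> [? ? ? ? ? ? ? ? ? ? ? ?] [rE iE aE bE] O; split; rewrite ?rE ?iE ?bE.
Qed.

Definition built (i j : nat) : state R -> Prop := building i j (out_words j) (out_reals j).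

(** 59 = 1 + 18 + 36 + 4: two steps for each of nine reals and eighteen words, and five register
    assignments. *)
Lemma halts_gadget i j dx e s : (j < N)%N -> built i j s ->
  xP R j.+1 = xP R j + dx%:~R -> reval s e = sigma R S j ->
  halts (gadget dx e) s 59 (built i j.+1).
Proof.
move=> jN [hn hi hp hN hK hH he h5 h6 h7 hin hout] xE eE.
have jS : (j < 3 * size S)%N := jN.
apply: (@halts_seq _ _ _ _ _ _ 1 58 (fun s' => s' = set_rvar s 8 (reval s e))).
  exact: halts_rset.
move=> _ ->; rewrite eE; set s1 := set_rvar s 8 _.
apply: (@halts_seq _ _ _ _ _ _ 18 40).
  apply: (@halts_pushr _ _ _ _ s1 (out_words j) (out_reals j)) => //.
  by rewrite size_out_reals /=; lia.
move=> s2 [A2 O2].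
apply: (@halts_seq _ _ _ _ _ _ 36 4).
  apply: halts_pushw O2 _ _ => //.
    by case: A2 => _ iE _ _; rewrite /= !iE//= hp; lia.
  by rewrite size_out_words /=; lia.
move=> s3 [A3 O3]; have A := agree_trans A2 A3.
have [rE iE aE bE] := A.
have e8 : rvar s3 8 = sigma R S j by rewrite rE.
have er k : k != 8%N -> rvar s3 k = rvar s k by rewrite rE /= /upd => /negbTE ->.
have ei k : k != 3%N -> k != 4%N -> ivar s3 k = ivar s k by exact: iE.
apply: (@halts_seq _ _ _ _ _ _ 1 3 (fun s' => s' = set_rvar s3 5 (xP R j.+1))).
  by apply: halts_rset; rewrite /= er// h5 xE.
move=> _ ->; set s4 := set_rvar s3 5 _.
apply: (@halts_seq _ _ _ _ _ _ 1 2 (fun s' => s' = set_rvar s4 6 (- j.+1%:R))).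
  by apply: halts_rset; rewrite /= /s4 /= /upd /= er// h6 -natr1 opprD.
move=> _ ->; set s5 := set_rvar s4 6 _.
apply: (@halts_seq _ _ _ _ _ _ 1 1 (fun s' => s' = set_rvar s5 7 (zP R S j.+1))).
  by apply: halts_rset; rewrite /= /s5 /s4 /= /upd /= er// e8 h7 zPS.
move=> _ ->; set s6 := set_rvar s5 7 _.
have p6 : ivar s6 5 = (3 * j).+2 by rewrite /s6 /s5 /s4 /= ei.
apply: halts_iset; first by rewrite [ieval _ _]/= -/s6 p6; lia.
split; rewrite /s6 /s5 /s4 /= /upd /= ?er ?ei //=.
- by rewrite hp; lia.
- by move=> k kS; rewrite bE; exact: hin.
have wE : out_words j.+1 = out_words j ++ map (ieval s2) gadget_tris.
  case: A2 => _ i2 _ _.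
  rewrite /out_words flatten_tri6S map_cat flatten_cat catA; congr (_ ++ _).
  by rewrite /= !i2// hp !addn1 !addn2 !addn3.
have yE : - j%:R - 1%:~R = - j.+1%:R :> R by rewrite -opprD natr1.
have lE : out_reals j.+1 = out_reals j ++ map (reval s1) (gadget_verts dx).
  rewrite /out_reals /points mkseqS flatten_rcons catA map_cat flatten_cat.
  congr (_ ++ _); rewrite /gadget_verts /s1 /= /upd /= hN hK hH he h5 h6 h7.
  by rewrite !sub0r -xE -zPS yE /spike (ltn_eqF jN).
by rewrite wE lE.
Qed.

Lemma reval_cur i j lw lr s : (i < size S)%N -> building i j lw lr s ->
  reval s cur = elt R S i.
Proof. by move=> iS b; rewrite /= (bi b) (bin b). Qed.

Lemma halts_build_body i s : (i < size S)%N -> built i (3 * i) s ->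
  halts build_body s 178 (built i.+1 (3 * i.+1)).
Proof.
move=> iS b0.
have [d0 m0] := @edivn3 i 0 isT; have [d1 m1] := @edivn3 i 1 isT.
have [d2 m2] := @edivn3 i 2 isT; rewrite addn0 addn1 addn2 in d0 m0 d1 m1 d2 m2.
have dx j : xP R j.+1 = xP R j +
    (if (j %% 3 == 0)%N then 1 else if (j %% 3 == 1)%N then -1 else 0).
  by rewrite -dxE addrC subrK.
have jN r : (r < 3)%N -> (3 * i + r < N)%N by exact: ltn3D.
apply: (@halts_seq _ _ _ _ _ _ 59 119 (built i (3 * i).+1)).
  apply: (halts_gadget _ b0); first by rewrite -(addn0 (3 * i)%N); exact: jN.
    by rewrite dx m0.
  by rewrite (reval_cur iS b0) /sigma m0 d0.
move=> s1 b1; apply: (@halts_seq _ _ _ _ _ _ 59 60 (built i (3 * i).+2)).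
  apply: (halts_gadget _ b1); first by rewrite -addn1; exact: jN.
    by rewrite dx m1.
  by rewrite (reval_cur iS b1) /sigma m1 d1.
move=> s2 b2; apply: (@halts_seq _ _ _ _ _ _ 59 1 (built i (3 * i).+3)).
  apply: (halts_gadget _ b2); first by rewrite -addn2; exact: jN.
    by rewrite dx m2.
  by rewrite -[LHS]/(0 - reval s2 cur / 2) (reval_cur iS b2) /sigma m2 d2 sub0r.
move=> s3 b3; apply: halts_iset; first by rewrite /= (bi b3); lia.
have -> : (3 * i.+1 = (3 * i).+3)%N by lia.
by case: b3 => *; split; rewrite //= /upd /=; lia.
Qed.

Lemma more_run i j lw lr s : (i < size S)%N -> building i j lw lr s -> beval s more.
Proof. by move=> iS b; rewrite /= (bn b) (bi b) -ltnNge. Qed.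

Lemma more_stop j lw lr s : building (size S) j lw lr s -> ~~ beval s more.
Proof. by move=> b; rewrite /= (bn b) (bi b) leqnn. Qed.

(** Real registers 5 to 7 keep their initial zeros, which are the coordinates of [ptP 0]. *)
Record scanned (k : nat) (s : state R) : Prop := Scanned {
  sn : ivar s 1 = size S;
  si : ivar s 2 = k;
  sQ : rvar s 0 = 1 + \sum_(i < k) elt R S i ^+ 2;
  sN : rvar s 1 = (3 * k)%:R;
  s567 : [/\ rvar s 5 = 0, rvar s 6 = 0 & rvar s 7 = 0];
  sin : forall k, (k < size S)%N -> rarr s 0 k = elt R S k;
  sout : output s [::] [::] }.

Lemma halts_scan_body k s : (k < size S)%N -> scanned k s ->
  halts scan_body s 3 (scanned k.+1).
Proof.
move=> kS [hn hi hQ hN [h5 h6 h7] hin hout].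
have cE : reval s cur = elt R S k by rewrite /= hi hin.
apply: (@halts_seq _ _ _ _ _ _ 1 2
  (fun s' => s' = set_rvar s 0 (1 + \sum_(i < k.+1) elt R S i ^+ 2))).
  apply: halts_rset; congr set_rvar.
  by rewrite big_ord_recr addrA -hQ expr2 -cE.
move=> _ ->; set s1 := set_rvar s 0 _.
apply: (@halts_seq _ _ _ _ _ _ 1 1 (fun s' => s' = set_rvar s1 1 (3 * k.+1)%:R)).
  by apply: halts_rset; congr set_rvar; rewrite mulnS addnC natrD -hN.
move=> _ ->; apply: halts_iset; first by rewrite /= hi; lia.
by split; rewrite //= /upd /= hi addn1.
Qed.

Lemma halts_scan s : scanned 0 s ->
  halts (While more scan_body) s (size S * 4).+1 (scanned (size S)).
Proof.
apply: halts_while => [k {}s kS sc|{}s sc].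
  by split; [rewrite /= (sn sc) (si sc) -ltnNge | exact: halts_scan_body].
by rewrite /= (sn sc) (si sc) leqnn.
Qed.

Lemma halts_constants s : scanned (size S) s ->
  halts constants s 5 (building 0 0 [::] [::]).
Proof.
move=> [hn hi hQ hN [h5 h6 h7] hin hout].
have QE : rvar s 0 = bigQ R S by rewrite hQ /bigQ (big_nth 0) big_mkord.
apply: (@halts_seq _ _ _ _ _ _ 1 4 (fun s' => s' = set_rvar s 2 (bigK R S))).
  by apply: halts_rset; rewrite /= hN.
move=> _ ->; set s1 := set_rvar s 2 _.
apply: (@halts_seq _ _ _ _ _ _ 1 3 (fun s' => s' = set_rvar s1 3 (bigH R S))).
  by apply: halts_rset; rewrite /= /upd /= hN QE.
move=> _ ->; set s2 := set_rvar s1 3 _.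
apply: (@halts_seq _ _ _ _ _ _ 1 2 (fun s' => s' = set_rvar s2 4 (eta R S))).
  exact: halts_rset.
move=> _ ->; set s3 := set_rvar s2 4 _.
apply: (@halts_seq _ _ _ _ _ _ 1 1 (fun s' => s' = set_ivar s3 2 0)).
  exact: halts_iset.
move=> _ ->; apply: halts_iset => //=; first lia.
split; rewrite //= /upd /= ?h5 ?h6 ?h7 ?oppr0//.
by rewrite /zP big_ord0 oppr0.
Qed.

Lemma halts_first s : building 0 0 [::] [::] s ->
  halts (Seq (pushr first_verts) (pushw sizes)) s 22 (built 0 0).
Proof.
move=> b; have [hn hi hp hN hK hH he h5 h6 h7 hin hout] := b.
apply: (@halts_seq _ _ _ _ _ _ 18 4).
  by apply: (@halts_pushr _ _ _ _ s [::] [::]) => //=; lia.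
move=> s1 [A1 O1]; have [r1 i1 a1 b1] := A1.
have b1' := building_agree b A1 O1.
apply: halts_imp.
  apply: (@halts_pushw _ _ _ _ s1 [::] ([::] ++ map (reval s) first_verts)) => //=; rewrite ?(bn b1'); lia.
move=> s2 [A2 O2]; have := building_agree b1' A2 O2.
congr (building _ _ _ _ s2).
  rewrite /out_words /= (bn b1').
  by congr [:: _; _]; rewrite /ngad; lia.
by rewrite /out_reals /= hK hH hN !sub0r oppr0 /zP big_ord0 oppr0.
Qed.

Lemma halts_build s : built 0 0 s ->
  halts (While more build_body) s (size S * 179).+1 (built (size S) N).
Proof.
move=> b; apply: (halts_while (Inv := fun i => built i (3 * i))).
- by move=> i {}s iS {}b; split; [exact: more_run iS b|exact: halts_build_body].
- by move=> s1; exact: more_stop.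
- by rewrite muln0.
Qed.

Lemma halts_last s : built (size S) N s ->
  halts (Seq (pushr last_verts) (pushw last_tris)) s 24
    (building (size S) N (enc_words (T : instance (prickliness_problem R)))
                         (enc_reals (T : instance (prickliness_problem R)))).
Proof.
move=> b; have [hn hi hp hN hK hH he h5 h6 h7 hin hout] := b.
have NE : N = (3 * size S)%N by [].
apply: (@halts_seq _ _ _ _ _ _ 6 18).
  by apply: (@halts_pushr _ _ _ _ s (out_words N) (out_reals N));
    rewrite ?size_out_reals //=; lia.
move=> s1 [A1 O1]; have [r1 i1 a1 b1] := A1.
have b1' := building_agree b A1 O1.
apply: halts_imp.
  by apply: (@halts_pushw _ _ _ _ s1 (out_words N) (out_reals N ++ map (reval s) last_verts));
    rewrite ?size_out_words //= ?(bp b1'); lia.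
move=> s2 [A2 O2]; have := building_agree b1' A2 O2.
congr (building _ _ _ _ s2).
  by rewrite gterrain_words /= (bp b1') !addn1.
rewrite gterrain_reals /coords /spike eqxx /= hK hH hN h5 h6 !sub0r.
by [].
Qed.

End Run.

Lemma halts_prepare (R : realType) (S : seq int) (W : nat) : (54 * size S + 12 <= W)%N ->
  halts W (prickliness_problem R)
    (Seq (ISet 1 (IGet 0 (ICst 0))) (Seq (RSet 0 (RCst 1))
    (Seq (While more scan_body) (Seq constants
    (Seq (Seq (pushr first_verts) (pushw sizes))
    (Seq (While more build_body) (Seq (pushr last_verts) (pushw last_tris))))))))
    (init (S : instance (threesum R))) (183 * size S + 55)
    (@building R S (size S) (ngad S)
      (enc_words (gterrain R S : instance (prickliness_problem R)))
      (enc_reals (gterrain R S : instance (prickliness_problem R)))).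
Proof.
move=> bigW; set s := init _.
have -> : (183 * size S + 55 =
  1 + (1 + ((size S * 4).+1 + (5 + (22 + ((size S * 179).+1 + 24))))))%N by lia.
apply: (@halts_seq _ _ _ _ _ _ _ _ (fun s' => s' = set_ivar s 1 (size S))).
  by apply: halts_iset => //=; lia.
move=> _ ->; set s1 := set_ivar s 1 _.
apply: (@halts_seq _ _ _ _ _ _ _ _ (fun s' => s' = set_rvar s1 0 1)).
  exact: halts_rset.
move=> _ ->; apply: halts_seq.
  apply: (@halts_scan R S W bigW).
  split => //; first by rewrite big_ord0 addr0.
  by move=> k kS; rewrite /= (nth_map 0).
move=> s2 /(halts_constants bigW) h2; apply: halts_seq h2 _.
move=> s3 /(halts_first bigW) h3; apply: halts_seq h3 _.
move=> s4 /(halts_build bigW) h4; apply: halts_seq h4 _.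
by move=> s5 /(halts_last bigW).
Qed.

Theorem theorem13 (R : realType) :
  reducible (fun n : nat => n%:R * ln n%:R) (threesum R) (prickliness_problem R).
Proof.
have ln2 : 0 < ln 2%:R :> R by rewrite ln_gt0// ltr1n.
have [C CP] : exists C : nat, 213 / ln 2%:R < C%:R :> R.
  by exists (Num.bound (213 / ln 2%:R : R)); apply: archi_boundP; rewrite divr_ge0// ltW.
(* The exponent 7 gives (n + 2)^7 >= 64 (n + 2) >= 54n + 12. From n = 2 on, the terrain has 9n + 4
   <= 11n vertices, the time is at most 183n + 58 <= 213n, and ln n >= ln 2 > 0, so that [C] absorbs
   the factor 213. *)
exists program, 7%N, 1%N, (11 + C)%N, 2%N => S uS.
set n := size S; set W := ((isize _ + 2) ^ 7)%N.
have bigW : (54 * n + 12 <= W)%N.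
  rewrite /W -[isize _]/n expnS.
  have : (2 ^ 6 <= (n + 2) ^ 6)%N by rewrite leq_exp2r//; lia.
  by rewrite -[(2 ^ 6)%N]/64%N => h; have := leq_mul (leqnn (n + 2)%N) h; lia.
have [s [t [ex tB b]]] := halts_prepare R bigW.
pose T : instance (prickliness_problem R) := gterrain R S.
pose s1 := set_ivar s 0 (answer T).
have [ow _ or _] := bout b.
have NE : ngad S = (3 * n)%N by [].
have aT : (answer T <= W)%N by apply: leq_trans (prickliness_le R S) _; lia.
have exq : exec W (prickliness_problem R) (Query 1 1 0) s s1 1 [:: isize T].
  apply: (@ExQuery R W (prickliness_problem R) s 1%N 1%N 0%N T) => //.
  exact: gterrain_is_terrain.
have W1 : (1 <= W)%N by lia.
pose s2 := set_ivar s1 0 `[< threesum_yes S >].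
have exi : exec W (prickliness_problem R)
    (If (ILe (IAdd (imul 3 (IVar 1)) (ICst 4)) (IVar 0)) (ISet 0 (ICst 1)) (ISet 0 (ICst 0)))
    s1 s2 2 [::].
  apply: ExIf.
  have -> : beval s1 (ILe (IAdd (imul 3 (IVar 1)) (ICst 4)) (IVar 0)) =
      `[< threesum_yes S >].
    rewrite -(prickliness_threesum R uS) /= /upd /= (bn b).
    by rewrite (_ : (size S + (size S + (size S + 0)) + 4)%N = (ngad S).+4)//; lia.
  by rewrite /s2; case: asboolP => _; apply: (ExISet _ 0 (e := ICst _)).
exists s2, (t + (1 + 2))%N, ([::] ++ ([:: isize T] ++ [::])); split => //.
  by apply: ExSeq ex _; apply: ExSeq exq exi.
move=> n2; have {}n2 : (2 <= n)%N by [].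
split.
  move=> m; rewrite inE => /eqP ->.
  rewrite -[isize T]/(size (verts (gterrain R S))) size_verts -[isize _]/n; lia.
rewrite -[isize _]/n.
have tn : (t + (1 + 2))%:R <= 213 * n%:R :> R by rewrite -natrM ler_nat; lia.
apply: (le_trans tn).
have n0 : 0 < n%:R :> R by rewrite ltr0n; lia.
have lnn : ln 2%:R <= ln n%:R :> R by rewrite ler_ln ?posrE ?ler_nat ?ltr0n//; lia.
rewrite natrD mulrCA mulrC ler_pM2l//.
rewrite ltr_pdivrMr// in CP.
apply: (le_trans (ltW CP)).
by rewrite ler_pM//; [exact: ltW | rewrite lerDr].
Qed.
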